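(* Let $T\ge T(d)$. If $q,r\in(0,1)$ satisfy $$\overline c_r-\frac{a(r)}2(q^2+1)\ge0,$$ then $$\overline c_1\ge\frac{4\overline c_r-2a(r)(q^2+1)}{(1-q)^2}.$$
   Context: Let $d\ge 1$ be an integer, $B(0,r)$ the Euclidean ball of radius $r$ centered at $0$ in $\mathbb{R}^d$. Set $T(1)=\frac12$, $T(2)=1$, $T(d)=\exp\big(\sum_{k=1}^{d/2-1}\frac1{d-2k}\big)$ for even $d>2$, and $T(d)=\frac12\exp\big(\sum_{k=1}^{(d-1)/2}\frac1{d-2k}\big)$ for odd $d>2$. (By a theorem of Fuglede, $C(x,y)=\ln\frac{T}{|x-y|}$ is positive definite on $B(0,1)$ if and only if $T\ge T(d)$.) $Z$ is the centered generalized Gaussian random field on $B(0,1)$ with covariance $C$: it is indexed by signed measures $\mu=\mu_+-\mu_-$ with $\mu_\pm$ non-negative and $\int\int|C(x,y)|\mu_\pm(dx)\mu_\pm(dy)<\infty$, and $\int Z(x)\mu(dx)$ is centered Gaussian with variance $\int\int C(x,y)\mu(dx)\mu(dy)$. Fix $0<\gamma<\sqrt{2d}$. The Gaussian multiplicative chaos (GMC) $M_\gamma(\cdot)$ is the random measure on $B(0,1)$ formally given by $M_\gamma(A)=\int_A e^{\gamma Z(x)-\frac{\gamma^2}{2}\mathbb{E}Z(x)^2}dx$ and rigorously defined as the limit, in probability and in $L^1(\mathbb{P})$ as $\epsilon\to0$, of $M_\gamma^{(\epsilon)}(A)=\int_A e^{\gamma Z_\epsilon(x)-\frac{\gamma^2}{2}\mathbb{E}Z_\epsilon(x)^2}dx$,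 where $Z_\epsilon$ is the convolution of $Z$ with $\theta_\epsilon(\cdot)=\theta(\cdot/\epsilon)$, $\theta$ being a non-negative Radon measure supported in the unit ball with $\theta(\mathbb{R}^d)=1$ and $\int|\ln|x-y||\theta(dy)<\infty$ (e.g. a smooth mollifier); the limit exists. Write $M_r=M_\gamma(B(0,r))$ for $r\in(0,1]$. Notation: $a(r)=\frac{1}{2\gamma^2\ln\frac1r}$ for $r\in(0,1)$, and for $0<r\le1$ $$\overline c_r=\sup\{c\ge0:\ \exists\,C>0\text{ such that }\mathbb{E}e^{-tM_r}\le Ce^{-c(\ln t)^2}\text{ for } t\ge1\}.$$ *)

(* Defs.v *)
From HB Require Import structures.
From mathcomp Require Export all_boot all_order all_algebra.
From mathcomp Require Export all_classical all_reals all_analysis measurable_realfun.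

Set Implicit Arguments.
Unset Strict Implicit.
Unset Printing Implicit Defensive.

Import Order.TTheory GRing.Theory Num.Theory.
Import numFieldNormedType.Exports.

Local Open Scope classical_set_scope.
Local Open Scope ring_scope.

(* R^d is [d.-tuple R]; its library sigma-algebra is generated by the
   coordinates, hence is the Borel sigma-algebra of R^d. *)

Section euclidean.
Context {R : realType}.
Implicit Types d : nat.

Definition enorm d (x : d.-tuple R) : R :=
  Num.sqrt (\sum_(i < d) tnth x i ^+ 2).

Definition edist d (x y : d.-tuple R) : R :=
  enorm [tuple tnth x i - tnth y i | i < d].

Definition eball d (r : R) : set (d.-tuple R) := [set x | enorm x < r].
Arguments eball : clear implicits.

Lemma measurable_enorm d : measurable_fun setT (@enorm d).
Proof.
apply: (@measurableT_comp _ _ _ _ _ _ (@Num.sqrt R)).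
  by apply: continuous_measurable_fun; exact: sqrt_continuous.
apply: measurable_sum => i; apply: measurable_funX.
exact: measurable_tnth.
Qed.

Lemma measurable_eball d (r : R) : measurable (eball d r).
Proof.
rewrite (_ : eball d r = @enorm d @^-1` `]-oo, r[).
  by rewrite -[X in measurable X]setTI; exact: measurable_enorm.
by apply/seteqP; split=> x; rewrite /eball /= in_itv.
Qed.

End euclidean.
Arguments eball {R} d r.
Arguments measurable_eball {R} d r.

Section lebesgue.
Context {R : realType}.
Local Notation mu1 := (@lebesgue_measure R).

Definition tcons n (z : measurableTypeR R * n.-tuple R) : n.+1.-tuple R := [tuple of z.1 :: z.2].

Lemma measurable_tcons n : measurable_fun setT (@tcons n).
Proof. exact: measurable_cons. Qed.

Section step.
Variables (n : nat) (mu : {sigma_finite_measure set (n.-tuple R) -> \bar R}).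

Definition lebesgue_step : set (n.+1.-tuple R) -> \bar R :=
  pushforward (mu1 \x mu)%E (@tcons n).

Let m0 : lebesgue_step set0 = 0%E.
Proof. by rewrite /lebesgue_step /pushforward preimage_set0 measure0. Qed.

Let m_ge0 A : (0 <= lebesgue_step A)%E.
Proof. by rewrite /lebesgue_step /pushforward; exact: measure_ge0. Qed.

Let m_sigma_additive : semi_sigma_additive lebesgue_step.
Proof.
move=> F mF tF mUF; rewrite /lebesgue_step /pushforward preimage_bigcup.
apply: measure_semi_sigma_additive.
- by move=> i; rewrite -[X in measurable X]setTI; exact: measurable_tcons.
- apply/trivIsetP => /= i j _ _ ij; rewrite -preimage_setI.
  by move/trivIsetP : tF => /(_ _ _ _ _ ij) ->//; rewrite preimage_set0.
- rewrite -preimage_bigcup -[X in measurable X]setTI.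
  exact: measurable_tcons.
Qed.

HB.instance Definition _ :=
  isMeasure.Build _ _ _ lebesgue_step m0 m_ge0 m_sigma_additive.

Let m_sigma_finite : sigma_finite setT lebesgue_step.
Proof.
have /sigma_finiteP[F [TF ndF Foo]] := sigma_finiteT mu1.
have /sigma_finiteP[G [TG ndG Goo]] := sigma_finiteT mu.
pose H k := [set x : n.+1.-tuple R | F k (thead x)] `&`
  [set x : n.+1.-tuple R | G k [tuple of behead x]].
exists H => [|k].
  apply/seteqP; split => // x _.
  have [i _ Fi] : (\bigcup_i F i) (thead x) by rewrite -TF.
  have [j _ Gj] : (\bigcup_i G i) [tuple of behead x] by rewrite -TG.
  exists (maxn i j) => //; split => /=.
  - by move: (thead x) Fi; exact/subsetPset/ndF/leq_maxl.
  - by move: [tuple of behead x] Gj; exact/subsetPset/ndG/leq_maxr.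
have [mFk Fkoo] := Foo k; have [mGk Gkoo] := Goo k; split.
  apply: measurableI.
  - by rewrite -[X in measurable X]setTI; exact: measurable_tnth.
  - by rewrite -[X in measurable X]setTI; exact: measurable_behead.
rewrite /lebesgue_step /pushforward (_ : _ @^-1` _ = F k `*` G k).
  by rewrite product_measure1E// lte_mul_pinfty// ge0_fin_numE.
apply/seteqP; split=> -[a t]; rewrite /H /tcons /= theadE;
  by rewrite (_ : [tuple of _] = t) //; exact/val_inj.
Qed.

HB.instance Definition _ :=
  Measure_isSigmaFinite.Build _ _ _ lebesgue_step m_sigma_finite.

End step.

(* Lebesgue measure on R^d as the d-fold product of the one-dimensional one *)
Fixpoint lebesgue_tuple d : {sigma_finite_measure set (d.-tuple R) -> \bar R} :=
  if d is n.+1 then lebesgue_step (lebesgue_tuple n) else \d_[tuple].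

Lemma lebesgue_tuple_box d (A : 'I_d -> set R) :
  (forall i, measurable (A i)) ->
  lebesgue_tuple d [set x | forall i, A i (tnth x i)] =
  (\prod_(i < d) mu1 (A i))%E.
Proof.
elim: d A => [|d IH] A mA /=.
  rewrite big_ord0 diracE; apply/eqP; rewrite eqe pnatr_eq1 eqb1.
  by rewrite inE => -[].
rewrite big_ord_recl -(IH (fun i => A (lift ord0 i)))//.
rewrite /lebesgue_step /pushforward -product_measure1E//; last first.
  rewrite (_ : mkset _ = \bigcap_(i in [set: 'I_d])
      [set x | A (lift ord0 i) (tnth x i)]); last first.
    by apply/seteqP; split=> x h i; [move=> _; exact: h|exact: h i Logic.I].
  apply: fin_bigcap_measurable => // i _.
  by rewrite -[X in measurable X]setTI; exact: measurable_tnth.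
  exact: mA.
congr (product_measure1 _ _ _); apply/seteqP; split=> -[a t] /=.
  move=> h; split; first by have := h ord0; rewrite tnth0.
  by move=> i; have := h (lift ord0 i); rewrite tnthS.
move=> [h0 h] i; case: (unliftP ord0 i) => [j|] ->; first by rewrite tnthS.
by rewrite tnth0.
Qed.

End lebesgue.

Section mollifier.
Context {R : realType} (d : nat).
Local Notation V := (d.-tuple R).

Definition affine_map (eps : R) (x y : V) : V :=
  [tuple tnth x i - eps * tnth y i | i < d].

Lemma measurable_affine_map eps x : measurable_fun setT (affine_map eps x).
Proof.
apply/measurable_fun_tnthP => i.
rewrite (_ : _ \o _ = fun y => tnth x i - eps * tnth y i); last first.
  by apply/funext => y /=; rewrite tnth_mktuple.
apply: measurable_funB => //; apply: measurable_funM => //.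
exact: measurable_tnth.
Qed.

HB.instance Definition _ eps x := @isMeasurableFun.Build _ _ _ _
  (affine_map eps x) (measurable_affine_map eps x).

(* The measure A |-> theta ((x - A) / eps) on B(0,1): integrating Z against it
   gives the convolution (Z * theta_eps)(x), where Z is extended by 0 outside
   B(0,1). The restriction to B(0,1) is vacuous as soon as |x| + eps < 1. *)
Definition mollified_dirac (theta : probability V R) (eps : R) (x : V)
    : {finite_measure set V -> \bar R} :=
  mrestr (distribution theta (affine_map eps x)) (measurable_eball d 1).

End mollifier.

Section gmc.
Context {R : realType} (d : nat) (dO : measure_display)
  (Omega : measurableType dO) (P : probability Omega R).
Local Notation V := (d.-tuple R).
Local Notation leb := (@lebesgue_tuple R d).
Local Notation ball1 := (eball d (1 : R)).

(* C(x,y) = ln (T / |x - y|), which is +oo on the diagonal; with the library's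
   total [ln] and [/], [ln (T / 0)] would be 0. *)
Definition log_kernel (T : R) (x y : V) : \bar R :=
  if x == y then +oo%E else (ln (T / edist x y))%:E.

(* Since |C| is bounded below near the diagonal, a measure of finite energy on
   the bounded set B(0,1) has finite mass; so finite measures suffice. *)
Definition finite_energy (T : R) (mu : {finite_measure set V -> \bar R}) :=
  mu (~` ball1) = 0%E /\
  (\int[mu]_x \int[mu]_y `|log_kernel T x y| < +oo)%E.

(* The signed measure mu_+ - mu_-; mu_+ and mu_- need not be mutually
   singular. *)
Record signed_measure := SignedMeasure {
  mpos : {finite_measure set V -> \bar R} ;
  mneg : {finite_measure set V -> \bar R} }.

Definition admissible T (mu : signed_measure) :=
  finite_energy T (mpos mu) /\ finite_energy T (mneg mu).

(* \int\int C(x,y) mu(dx) nu(dy) *)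
Definition log_pairing T (mu nu : signed_measure) : R :=
  let I (m1 m2 : {finite_measure set V -> \bar R}) :=
    fine (\int[m1]_x \int[m2]_y log_kernel T x y)%E in
  I (mpos mu) (mpos nu) - I (mpos mu) (mneg nu)
  - I (mneg mu) (mpos nu) + I (mneg mu) (mneg nu).

(* X ~ N(0, v); [normal_prob 0 0] is not the Dirac mass at 0 in the library. *)
Definition centered_gaussian (X : Omega -> R) (v : R) :=
  (v = 0 /\ {ae P, forall w, X w = 0}) \/
  (0 < v /\ forall A : set R, measurable A ->
    P (X @^-1` A) = normal_prob 0 (Num.sqrt v) A).

(* Applied to the coefficients (1, -a, -b) and the signed measures
   (a mu + b nu, mu, nu), the condition yields the a.s. linearity of Z. The
   values of Z at non-admissible measures are irrelevant. *)
Definition log_gaussian_field T (Z : signed_measure -> {RV P >-> R}) :=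
  forall (n : nat) (c : 'I_n -> R) (mu : 'I_n -> signed_measure),
    (forall i, admissible T (mu i)) ->
    centered_gaussian (fun w => \sum_(i < n) c i * Z (mu i) w)
      (\sum_(i < n) \sum_(j < n) c i * c j * log_pairing T (mu i) (mu j)).

(* Radon probability measures are the Borel ones on R^d; note that
   [`|log_kernel 1 x y|] is |ln |x - y||. *)
Definition mollifier (theta : probability V R) :=
  theta [set x | 1 < enorm x] = 0%E /\
  forall x, (\int[theta]_y `|log_kernel 1 x y| < +oo)%E.

Definition mollified_index (theta : probability V R) (eps : R) (x : V) :=
  SignedMeasure (mollified_dirac theta eps x) mzero.

(* Zeps eps x is Z_eps(x), for a version that is jointly measurable in (x, w),
   so that it can be integrated in x for fixed w. *)
Definition convolution_of T (Z : signed_measure -> {RV P >-> R})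
    (theta : probability V R) (Zeps : R -> V -> Omega -> R) :=
  forall eps, 0 < eps ->
    (forall x, ball1 x -> admissible T (mollified_index theta eps x) /\
       {ae P, forall w, Zeps eps x w = Z (mollified_index theta eps x) w}) /\
    measurable_fun (ball1 `*` [set: Omega])
      (fun z : V * Omega => Zeps eps z.1 z.2).

Definition gmc_approx (gamma : R) (Zeps : R -> V -> Omega -> R) (eps : R)
    (A : set V) (w : Omega) : \bar R :=
  (\int[leb]_(x in A) (expR (gamma * Zeps eps x w -
     gamma ^+ 2 / 2 * fine 'E_P[(fun w' => Zeps eps x w' ^+ 2)]))%:E)%E.

(* The random measure M is the limit, in probability and in L^1, of the
   approximations. *)
Definition gmc_limit (gamma : R) (Zeps : R -> V -> Omega -> R)
    (M : R.-ker Omega ~> V) :=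
  forall A : set V, measurable A -> A `<=` ball1 ->
    (forall delta : R, 0 < delta ->
      P [set w | (delta%:E < `|gmc_approx gamma Zeps eps A w - M w A|)%E]
        @[eps --> (0 : R)^'+] --> 0%E) /\
    (\int[P]_w `|gmc_approx gamma Zeps eps A w - M w A|)%E
      @[eps --> (0 : R)^'+] --> 0%E.

(* E[exp(- t M_r)] with M_r = M(B(0,r)) *)
Definition laplace (M : R.-ker Omega ~> V) (r t : R) : \bar R :=
  (\int[P]_w expeR (- (t%:E * M w (eball d r))))%E.

Definition cbar (M : R.-ker Omega ~> V) (r : R) : \bar R :=
  ereal_sup [set c%:E | c in [set c : R | 0 <= c /\
    exists2 C : R, 0 < C & forall t : R, 1 <= t ->
      (laplace M r t <= (C * expR (- c * ln t ^+ 2))%:E)%E]].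

End gmc.

(* The case distinctions d = 1 and d = 2 are the instances with an empty sum. *)
Definition Tcrit (R : realType) (d : nat) : R :=
  if odd d then 2^-1 * expR (\sum_(1 <= k < (d.-1)./2.+1) ((d - 2 * k)%:R)^-1)
  else expR (\sum_(1 <= k < d./2) ((d - 2 * k)%:R)^-1).

Definition acoef (R : realType) (gamma r : R) : R :=
  (2 * gamma ^+ 2 * ln r^-1)^-1.

(* Main.v *)
From HB Require Import structures.
Require Import Defs.
From mathcomp Require Import all_boot all_order all_algebra.
From mathcomp Require Import all_classical all_reals all_analysis.
From mathcomp Require Import ring lra.

(** The logarithmic kernel satisfies [C(rx, ry) = C(x, y) + ln(1/r)]. Hence the
    field mollified at scale [e] and seen at the points [ry] has the law of
    [Z_(e/r)(y) + sigma N], where [sigma^2 = ln(1/r)] and [N] is a standard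
    normal variable independent of [Z]. Exponentiating and integrating, [M_r] has
    the law of [K exp(g sigma N) M_1] for an explicit constant [K]. On the event
    [N <= - b] the random factor is at most [exp(- g sigma b)], so
    [P(N <= - b) E exp(- t K exp(- g sigma b) M_1) <= E exp(- t M_r)]
    for all [t > 0] and all real [b] ([gmc_laplace_ge]).

    Given [s >= 1], this is used with [ln t = 2 ln s / (1 - q)] and with the [b]
    for which [t K exp(- g sigma b) = s], that is
    [g sigma b = (1 + q) / 2 * ln t + ln K]. Then [1 / P(N <= - b)] grows like
    [exp(b^2 / 2)], whose leading term is [exp(a ((1 + q) / 2)^2 (ln t)^2)] with
    [a = a(r)], while [E exp(- t M_r)] is at most [C exp(- c (ln t)^2)]. The claimed
    exponent concedes the further amount [a ((1 - q) / 2)^2 (ln t)^2], which absorbs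
    the terms linear in [ln t]; the total is [c - a (q^2 + 1) / 2] times [(ln t)^2],
    and [(ln t)^2 = 4 (ln s)^2 / (1 - q)^2] ([gaussian_decay_transfer]).

    Three points need care. The two families of Gaussian variables are compared
    through their finite linear combinations only, whereas the mass of a ball is
    an integral over uncountably many of them; [laplace_exponential_mass_eq]
    bridges this by moments of a bounded substitute for the exponential. The
    covariances must be absolutely convergent integrals for the identity
    [C(rx, ry) = C(x, y) + ln(1/r)] to be integrated term by term; this follows
    from positive definiteness ([mutual_energy_lty]). Finally, the mollified
    identities hold only for balls of radius [rho] with [rho + e / r < 1], where no
    mass of the mollifier leaves the unit ball; the inequality is therefore proved
    on such balls, then [e] tends to 0 using the convergence in [L^1], and [rho]
    tends to 1. *)

Set Implicit Arguments.
Unset Strict Implicit.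
Unset Printing Implicit Defensive.

Import Order.TTheory GRing.Theory Num.Theory.
Import numFieldNormedType.Exports.

Local Open Scope classical_set_scope.
Local Open Scope ring_scope.

(** * Changes of variables and the standard normal law *)

Lemma integral_probability_cst {R : realType} d (T : measurableType d)
  (P : probability T R) (k : \bar R) : (\int[P]_w k = k)%E.
Proof. by rewrite integral_cst// [X in (_ * X)%E]probability_setT mule1. Qed.

Section affine.
Context {R : realType}.
Local Notation mu := (@lebesgue_measure R).
Local Notation RM := (measurableTypeR R).

Definition affine (a b : R) (x : RM) : RM := a * x + b.

Lemma measurable_affine (a b : R) : measurable_fun [set: RM] (affine a b).
Proof. by apply: measurable_funD => //; exact: measurable_funM. Qed.

HB.instance Definition _ a b :=
  @isMeasurableFun.Build _ _ _ _ (affine a b) (measurable_affine a b).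

Lemma lebesgue_measure_affine (a b : R) (A : set RM) : a != 0 -> measurable A ->
  (`|a|%:E * pushforward mu (affine a b) A)%E = mu A.
Proof.
move=> a0 mA.
have ma := measurable_affine a b.
pose m' : {measure set RM -> \bar R} := mscale (NngNum (normr_ge0 a))
  (@measure_function_pushforward__canonical__measure_function_Measure _ _ RM RM
    R mu _ ma).
suff /(_ A mA) -> : forall B, measurable B -> mu B = m' B by [].
apply: lebesgue_measure_unique => // _ [[p q] _ <-] /=.
rewrite /m' /mscale/= /pushforward.
have [pq|qp] := ltP p q; last first.
  by rewrite set_itv_ge ?bnd_simp -?leNgt// preimage_set0 !measure0 mule0.
have [a_gt0|a_lt0|a00] := ltgtP 0 a; last by rewrite -a00 eqxx in a0.
- have -> : affine a b @^-1` `]p, q] = `](p - b) / a, (q - b) / a]%classic.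
    by apply/seteqP; split => x /=; rewrite !in_itv/= ltr_pdivrMr// ler_pdivlMr//;
      rewrite ltrBlDr lerBrDr /affine mulrC.
  rewrite !lebesgue_measure_itv/= !lte_fin pq ltr_pM2r ?invr_gt0// ltrD2r pq.
  rewrite gtr0_norm// -!EFinB -EFinM; congr EFin; field.
  by rewrite gt_eqF.
- have -> : affine a b @^-1` `]p, q] = `[(q - b) / a, (p - b) / a[%classic.
    by apply/seteqP; split => x /=; rewrite !in_itv/= ler_ndivrMr// ltr_ndivlMr//;
      rewrite ltrBlDr lerBrDr /affine mulrC andbC.
  rewrite !lebesgue_measure_itv/= !lte_fin pq ltr_nM2r ?invr_lt0// ltrD2r pq.
  rewrite ltr0_norm// -!EFinB -EFinM; congr EFin; field.
  by rewrite lt_eqF.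
Qed.

Lemma integral_affine (a b : R) (f : RM -> \bar R) : a != 0 ->
  measurable_fun setT f -> (forall x, 0 <= f x)%E ->
  (\int[mu]_x (`|a|%:E * f (a * x + b)%R) = \int[mu]_x f x)%E.
Proof.
move=> a0 mf f0.
rewrite ge0_integralZl//; last by apply: (measurableT_comp mf); exact: measurable_affine.
have := @ge0_integral_pushforward _ _ _ _ _ _ (measurable_affine a b) mu setT f.
rewrite preimage_setT /comp /= => <- //.
rewrite -(@ge0_integral_mscale _ _ _ _ _ _ (NngNum (normr_ge0 a)))//.
by apply: eq_measure_integral => A mA _; exact: (lebesgue_measure_affine b a0 mA).
Qed.

End affine.

Section density.
Local Open Scope ereal_scope.
Context d (T : measurableType d) (R : realType).
Variables (mu nu : {measure set T -> \bar R}) (p : T -> R).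
Hypotheses (mp : measurable_fun setT p) (p0 : forall x, (0 <= p x)%R).
Hypothesis nuE : forall A, measurable A -> nu A = \int[mu]_(x in A) (p x)%:E.
Import HBNNSimple.

(** A measure with density [p] integrates [f] to the integral of [f * p]; by
    monotone approximation it suffices to check simple functions. *)
Lemma ge0_integral_density (f : T -> \bar R) :
  measurable_fun setT f -> (forall x, 0 <= f x) ->
  \int[nu]_x f x = \int[mu]_x (f x * (p x)%:E).
Proof.
move=> mf f0.
pose f_ := nnsfun_approx measurableT mf.
have f_cvg x : (f_ n x)%:E @[n --> \oo] --> f x by exact: cvg_nnsfun_approx.
transitivity (limn (fun n => \int[nu]_x (f_ n x)%:E)).
  rewrite -monotone_convergence//.
  - by apply: eq_integral => x _; apply/esym/cvg_lim => //; exact: f_cvg.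
  - by move=> n; exact/measurable_EFinP.
  - by move=> n x _; rewrite lee_fin.
  - by move=> x _ a b ab; rewrite lee_fin; exact/lefP/nd_nnsfun_approx.
transitivity (limn (fun n => \int[mu]_x ((f_ n x)%:E * (p x)%:E))); last first.
  rewrite -monotone_convergence//.
  - apply: eq_integral => x _; apply/cvg_lim => //.
    by apply: cvgeZr => //; exact: f_cvg.
  - by move=> n; apply/measurable_EFinP; exact: measurable_funM.
  - by move=> n x _; rewrite -EFinM lee_fin mulr_ge0.
  - move=> x _ a b ab; rewrite -!EFinM lee_fin ler_wpM2r//.
    exact/lefP/nd_nnsfun_approx.
congr (limn _); apply/funext => n.
transitivity (\sum_(k \in range (f_ n)) k%:E * nu (f_ n @^-1` [set k])).
  by rewrite integralT_nnsfun sintegralE.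
transitivity (\int[mu]_x \sum_(k \in range (f_ n))
    (k * \1_(f_ n @^-1` [set k]) x)%:E * (p x)%:E); last first.
  apply: eq_integral => x _; rewrite -ge0_mule_fsuml; last first.
    by move=> k; exact: nnfun_muleindic_ge0.
  by rewrite fsumEFin// -fimfunE.
rewrite ge0_integral_fsum//; last 2 first.
- move=> k; apply/measurable_EFinP; apply: measurable_funM => //.
  exact: measurable_funM.
- by move=> k x _; rewrite mule_ge0 ?lee_fin//; exact: nnfun_muleindic_ge0.
apply: eq_fsbigr => k kr.
have [k0|k0] := ltP k 0%R.
  rewrite preimage_nnfun0// measure0 mule0.
  by rewrite integral0_eq// => x _; rewrite indic0 mulr0 mul0e.
under eq_integral do rewrite EFinM -muleA.
rewrite ge0_integralZl//; last 2 first.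
- by apply/measurable_EFinP; apply: measurable_funM.
- by move=> x _; rewrite -EFinM lee_fin mulr_ge0.
congr (_ * _); rewrite nuE// integral_mkcond; apply: eq_integral => x _.
by rewrite patchE indicE; case: ifPn => _; rewrite ?mul1e ?mul0e.
Qed.
End density.

Section standard_gaussian.
Context {R : realType}.
Local Notation mu := (@lebesgue_measure R).
Local Notation RM := (measurableTypeR R).
Local Notation N01 := (@normal_prob R 0 1).
Local Notation phi := (@normal_pdf R 0 1).

Lemma normal_pdf_scale (s z : R) : 0 < s -> s * normal_pdf 0 s (s * z) = phi z.
Proof.
move=> s0; rewrite !normal_pdfE ?oner_neq0 ?gt_eqF// /normal_peak /normal_fun.
rewrite !subr0 mulrA; congr (_ * expR _).
  rewrite expr1n mul1r -mulrnAr sqrtrM ?sqr_ge0// sqrtr_sqr gtr0_norm// invfM.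
  by rewrite mulrA mulfV ?gt_eqF// mul1r.
by rewrite exprMn expr1n; field; rewrite gt_eqF.
Qed.

Lemma normal_pdf01E z : phi z = normal_peak 1 * expR (- (z ^+ 2 / 2)).
Proof. by rewrite normal_pdfE ?oner_neq0// /normal_fun subr0 expr1n mulNr. Qed.

Lemma ge0_integral_normal (s : R) (h : RM -> \bar R) :
  measurable_fun setT h -> (forall x, 0 <= h x)%E ->
  (\int[normal_prob 0 s]_x h x = \int[mu]_x (h x * (normal_pdf 0 s x)%:E))%E.
Proof.
move=> mh h0; apply: ge0_integral_density => //.
  exact: measurable_normal_pdf.
by move=> x; exact: normal_pdf_ge0.
Qed.

Lemma measurable_EFin_phi d (T : measurableType d) (f : T -> RM) : measurable_fun setT f ->
  measurable_fun setT (fun x => (phi (f x))%:E).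
Proof.
by move=> mf; apply/measurable_EFinP/measurableT_comp => //;
  exact: measurable_normal_pdf.
Qed.

Lemma ge0_integral_normal_scale (s : R) (h : RM -> \bar R) : 0 < s ->
  measurable_fun setT h -> (forall x, 0 <= h x)%E ->
  (\int[normal_prob 0 s]_x h x = \int[N01]_z h (s * z)%R)%E.
Proof.
move=> s0 mh h0; have ms := @measurable_affine R s 0.
have mhs : measurable_fun setT (fun z : RM => h (s * z)).
  by apply: (measurableT_comp mh); exact: measurable_funM.
rewrite (ge0_integral_normal s mh h0) (ge0_integral_normal 1 mhs (fun=> h0 _)).
rewrite -(integral_affine (a := s) 0)//; first last.
- by move=> x; rewrite mule_ge0// lee_fin normal_pdf_ge0.
- apply: emeasurable_funM => //; apply/measurable_EFinP.
  exact: measurable_normal_pdf.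
- by rewrite gt_eqF.
apply: eq_integral => z _; rewrite addr0 gtr0_norm// muleCA -EFinM.
by rewrite normal_pdf_scale.
Qed.

(** The law of [a N + b N'] for independent standard normal [N], [N']. The
    substitution [z = (a x + b y) / c] in the inner integral turns the product of
    densities into a product of a density in [z] and a normal density in [y],
    by the identity [c^2 = a^2 + b^2]; then [y] integrates out. *)
Lemma normal_rotate_neq0 (a b : R) (h : RM -> \bar R) : a != 0 ->
  measurable_fun setT h -> (forall x, 0 <= h x)%E ->
  (\int[N01]_y \int[N01]_x h (a * x + b * y)%R =
   \int[N01]_z h (Num.sqrt (a ^+ 2 + b ^+ 2) * z)%R)%E.
Proof.
move=> a0 mh h0; set c := Num.sqrt _.
have c2 : c ^+ 2 = a ^+ 2 + b ^+ 2 by rewrite sqr_sqrtr// addr_ge0 ?sqr_ge0.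
have c0 : 0 < c by rewrite sqrtr_gt0 ltr_pwDl ?sqr_ge0// exprn_even_gt0.
have ca0 : c / a != 0 by rewrite mulf_neq0 ?invr_eq0// gt_eqF.
have mhc : measurable_fun setT (fun z : RM => h (c * z)).
  by apply: (measurableT_comp mh); exact: measurable_funM.
pose F (y z : RM) : \bar R :=
  (`|c / a|%:E * (h (c * z)%R * (phi z)%:E * (phi (c / a * y - b / a * z))%:E))%E.
have F0 y z : (0 <= F y z)%E.
  by rewrite /F !mule_ge0// ?lee_fin ?normal_pdf_ge0.
have mF : measurable_fun setT (fun p : RM * RM => F p.1 p.2).
  apply: emeasurable_funM => //; apply: emeasurable_funM.
    apply: emeasurable_funM; first exact: measurableT_comp mhc _.
    exact: measurable_EFin_phi.
  apply: measurable_EFin_phi.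
  by apply: measurable_funB; apply: measurable_funM.
have phiM x z : phi (c / a * z - b / a * x) * phi x = phi z * phi (c / a * x - b / a * z).
  rewrite !normal_pdf01E mulrACA [RHS]mulrACA -!expRD; congr (_ * expR _).
  have -> : c ^+ 2 = a ^+ 2 + b ^+ 2 -> forall x z, (c / a * z - b / a * x) ^+ 2 =
     z ^+ 2 - x ^+ 2 + (c * x - b * z) ^+ 2 / a ^+ 2.
    move=> {}c2 {}x {}z.
    have -> : (c / a * z - b / a * x) ^+ 2 =
     (c ^+ 2 * (z ^+ 2 - x ^+ 2) - b ^+ 2 * (z ^+ 2 - x ^+ 2) + (c * x - b * z) ^+ 2) / a ^+ 2.
      by field.
    by rewrite c2; field.
  - have -> : (c / a * x - b / a * z) = (c * x - b * z) / a by field.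
    by rewrite expr_div_n; field.
  by [].
transitivity (\int[mu]_y \int[mu]_z F y z)%E.
  rewrite ge0_integral_normal//; last 2 first.
  - apply: (@measurable_fun_fubini_tonelli_F _ _ _ _ _ N01 (fun p => h (a * p.2 + b * p.1))) => //.
    apply: (measurableT_comp mh); apply: measurable_funD; exact: measurable_funM.
  - by move=> y; apply: integral_ge0.
  apply: eq_integral => y _.
  have mhy : measurable_fun setT (fun x : RM => h (a * x + b * y)).
    by apply: (measurableT_comp mh); apply: measurable_funD => //; exact: measurable_funM.
  rewrite ge0_integral_normal// -ge0_integralZr//; last 3 first.
  - by apply: emeasurable_funM => //; exact: (measurable_EFin_phi (f := id)).
  - by move=> x _; rewrite mule_ge0// lee_fin normal_pdf_ge0.
  - by rewrite lee_fin normal_pdf_ge0.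
  rewrite -[LHS](integral_affine (- (b / a * y)) ca0); last 2 first.
  - by apply: emeasurable_funM => //; apply: emeasurable_funM => //;
      exact: (measurable_EFin_phi (f := id)).
  - by move=> x; rewrite !mule_ge0// lee_fin normal_pdf_ge0.
  apply: eq_integral => z _; rewrite /F; congr (_ * _)%E.
  rewrite -!muleA -!EFinM phiM; congr (h _ * _)%E.
  by field.
rewrite (@fubini_tonelli _ _ _ _ _ mu mu (fun p => F p.1 p.2))//= ge0_integral_normal//.
apply: eq_integral => z _.
transitivity (\int[mu]_y ((h (c * z)%R * (phi z)%:E) *
   (`|c / a|%:E * (phi (c / a * y + - (b / a * z)))%:E)))%E.
  by apply: eq_integral => y _; rewrite /F muleCA.
rewrite ge0_integralZl//; last 3 first.
- apply: emeasurable_funM => //; apply: measurable_EFin_phi.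
  by apply: measurable_funB => //; exact: measurable_funM.
- by move=> y _; rewrite mule_ge0// lee_fin normal_pdf_ge0.
- by rewrite mule_ge0// lee_fin normal_pdf_ge0.
rewrite (integral_affine (- (b / a * z)) (f := fun y => (phi y)%:E) ca0); last 2 first.
- exact: (measurable_EFin_phi (f := id)).
- by move=> x; rewrite lee_fin normal_pdf_ge0.
by rewrite integral_normal_pdf mule1.
Qed.

Lemma normal_rotate (a b : R) (h : RM -> \bar R) :
  measurable_fun setT h -> (forall x, 0 <= h x)%E ->
  (\int[N01]_y \int[N01]_x h (a * x + b * y)%R =
   \int[N01]_z h (Num.sqrt (a ^+ 2 + b ^+ 2) * z)%R)%E.
Proof.
move=> mh h0; have [->|a0] := eqVneq a 0; last exact: normal_rotate_neq0.
rewrite expr0n add0r sqrtr_sqr.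
under eq_integral do (under eq_integral do rewrite mul0r add0r; rewrite integral_probability_cst).
have [b0|b0] := leP 0 b; first by rewrite ger0_norm.
have mhb (k : R) : measurable_fun setT (fun z : RM => h (k * z)).
  by apply: (measurableT_comp mh); exact: measurable_funM.
rewrite ltr0_norm//.
rewrite (ge0_integral_normal 1 (mhb b) (fun=> h0 _)) (ge0_integral_normal 1 (mhb (- b)) (fun=> h0 _)).
have N1 : (-1 : R) != 0 by rewrite oppr_eq0 oner_neq0.
rewrite -[LHS](integral_affine 0 N1); last 2 first.
- by apply: emeasurable_funM => //; exact: (measurable_EFin_phi (f := id)).
- by move=> x; rewrite mule_ge0// lee_fin normal_pdf_ge0.
apply: eq_integral => z _.
by rewrite addr0 normrN1 mul1e mulN1r mulrN mulNr !normal_pdf01E sqrrN.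
Qed.

(** Completing the square bounds [exp(c |z|)] times the standard density by a
    multiple of the density of variance 2. *)
Lemma expR_normal_moment (c : R) :
  (\int[N01]_z (expR (c * `|z|))%:E < +oo)%E.
Proof.
have mE : measurable_fun setT (fun z : RM => (expR (c * `|z|))%:E).
  apply/measurable_EFinP; apply: measurableT_comp => //; exact: measurable_funM.
rewrite ge0_integral_normal//.
have s2 : Num.sqrt 2 != 0 :> R by rewrite gt_eqF// sqrtr_gt0.
pose K : R := normal_peak 1 * expR (c ^+ 2) / normal_peak (Num.sqrt 2).
have K0 : 0 <= K by rewrite !mulr_ge0 ?expR_ge0 ?invr_ge0 ?normal_peak_ge0.
apply: (@le_lt_trans _ _ (\int[mu]_z (K%:E * (normal_pdf 0 (Num.sqrt 2) z)%:E))%E).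
  apply: ge0_le_integral => //.
  - by move=> x _; rewrite mule_ge0// lee_fin ?expR_ge0 ?normal_pdf_ge0.
  - by apply: emeasurable_funM => //; exact: (measurable_EFin_phi (f := id)).
  - by apply: emeasurable_funM => //; apply/measurable_EFinP; exact: measurable_normal_pdf.
  - move=> x _; rewrite -!EFinM lee_fin normal_pdf01E normal_pdfE// /normal_fun subr0.
    rewrite sqr_sqrtr// /K [leRHS]mulrA divfK ?gt_eqF ?normal_peak_gt0//.
    rewrite mulrCA -!mulrA ler_pM2l ?normal_peak_gt0 ?oner_neq0// -!expRD ler_expR.
    rewrite (_ : 2 *+ 2 = 4 :> R); last by rewrite -mulr_natr -natrM.
    rewrite -[x ^+ 2](real_normK (num_real x)) mulNr.
    have -> : x * (x / 2) = `|x| ^+ 2 / 2 by rewrite (real_normK (num_real x)) mulrA.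
    have := sqr_ge0 (c - `|x| / 2); rewrite sqrrB -subr_ge0 => h.
    rewrite -subr_ge0; apply: le_trans h _.
    by rewrite le_eqVlt; apply/orP; left; apply/eqP; field.
rewrite ge0_integralZl//; last 2 first.
- by apply/measurable_EFinP; exact: measurable_normal_pdf.
- by move=> x _; rewrite lee_fin normal_pdf_ge0.
by rewrite integral_normal_pdf mule1 ltry.
Qed.

(** The interval [[-b - 1, -b]] has length 1 and the density is at least its
    value at distance [|b| + 1] there. *)
Lemma normal_tail_ge (b : R) :
  ((normal_peak 1 * expR (- ((`|b| + 1) ^+ 2 / 2)))%:E
    <= N01 [set z | (z <= - b)%R])%E.
Proof.
pose A : set RM := `[- b - 1, - b]%classic.
have mA : measurable A by exact: measurable_itv.
have muA : mu A = 1%E.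
  by rewrite lebesgue_measure_itv/= lte_fin ltrBlDr ltrDl ltr01 -EFinB opprB addrC addrNK.
apply: (@le_trans _ _ (N01 A)); last first.
  apply: le_measure; rewrite ?inE//.
  - rewrite (_ : mkset _ = `]-oo, - b]%classic); first exact: measurable_itv.
    by apply/seteqP; split=> x; rewrite /= in_itv.
  - by move=> x; rewrite /A/= in_itv/= => /andP[].
rewrite -[leLHS]mule1 -muA -integral_cst//; apply: ge0_le_integral => //.
- by move=> x _; rewrite lee_fin mulr_ge0 ?normal_peak_ge0 ?expR_ge0.
- by apply: measurable_funTS; exact: (measurable_EFin_phi (f := id)).
- move=> x; rewrite /A/= in_itv/= => /andP[x1 x2]; rewrite lee_fin normal_pdf01E.
  rewrite ler_pM2l ?normal_peak_gt0 ?oner_neq0// ler_expR lerN2 ler_pM2r ?invr_gt0//.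
  rewrite -[x ^+ 2](real_normK (num_real x)) lerXn2r ?nnegrE ?addr_ge0//.
  by rewrite ler_norml; have := ler_norm b; have := ler_norm (- b); rewrite normrN; lra.
Qed.

End standard_gaussian.

Section centered_gaussian_law.
Context {R : realType} d (Omega : measurableType d) (P : probability Omega R).
Local Notation RM := (measurableTypeR R).
Local Notation N01 := (@normal_prob R 0 1).

Lemma centered_gaussian_integral (X : Omega -> RM) (v : R) (h : RM -> \bar R) :
  measurable_fun setT X -> centered_gaussian P X v ->
  measurable_fun setT h -> (forall x, 0 <= h x)%E ->
  (\int[P]_w h (X w) = \int[N01]_z h (Num.sqrt v * z)%R)%E.
Proof.
move=> mX gX mh h0; case: gX => [[-> X0]|[v0 XN]].
  rewrite sqrtr0; under [RHS]eq_integral do rewrite mul0r.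
  rewrite integral_probability_cst.
  transitivity (\int[P]_w cst (h 0%R) w)%E.
    apply: ge0_ae_eq_integral => //.
    - exact: (measurableT_comp mh).
    - by move=> w _; exact: h0.
    - by apply: filterS X0 => w Xw _; rewrite Xw.
  exact: integral_probability_cst.
rewrite -ge0_integral_normal_scale ?sqrtr_gt0//.
have := @ge0_integral_pushforward _ _ _ _ _ _ mX P setT h.
rewrite preimage_setT /comp /= => <- //.
by apply: eq_measure_integral => A mA _; exact: XN.
Qed.

Lemma centered_gaussian_var_ge0 (X : Omega -> R) (v : R) :
  centered_gaussian P X v -> 0 <= v.
Proof. by case=> [[->//]|[/ltW]]. Qed.

End centered_gaussian_law.

(** * Equality in law of exponential masses *)

Section exp_of_sine.
Context {R : realType}.
Implicit Types (x g : R) (u : nat -> R).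

Lemma normr_sin_le x : `|sin x| <= `|x|.
Proof.
wlog x0 : x / 0 <= x.
  move=> h; have [/h//|/ltW xlt0] := leP 0 x.
  by rewrite -normrN -sinN -[leRHS]normrN; apply: h; rewrite oppr_ge0.
have [|c _] := @MVT_segment R sin cos 0 x x0.
  by apply: continuous_subspaceT; exact: continuous_sin.
rewrite sin0 !subr0 => ->; rewrite normrM -[leRHS]mul1r.
by rewrite ler_wpM2r// cos_max.
Qed.

Lemma cvg_natmul_sin x : n.+1%:R * sin (x / n.+1%:R) @[n --> \oo] --> x.
Proof.
have [->|x0] := eqVneq x 0.
  under eq_fun do rewrite mul0r sin0 mulr0.
  exact: cvg_cst.
have sin'0 : h^-1 * sin h @[h --> (0:R)^'] --> (1 : R).
  have h := is_derive_sin (0 : R).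
  have /cvg_ex[l ll] := @ex_derive _ _ _ _ _ _ _ h.
  have e : (fun h => h^-1 *: ((sin \o shift 0) (h *: 1) - sin 0)) = (fun h : R => h^-1 * sin h).
    by apply/funext => k; rewrite /= addr0 sin0 subr0 [_%:A]mulr1.
  rewrite e in ll.
  suff <- : l = 1 by [].
  have := @derive_val _ _ _ _ _ _ _ h.
  by rewrite cos0 /derive e => <-; apply/esym/cvg_lim.
have h0 : x / n.+1%:R @[n --> \oo] --> (0 : R)^'.
  have h0' : x / n.+1%:R @[n --> \oo] --> (0 : R).
    by rewrite -(mulr0 x); apply: cvgM; [exact: cvg_cst|exact: cvg_harmonic].
  move=> A; rewrite /dnbhs /within/= => HA.
  have : \forall n \near \oo, x / n.+1%:R != 0 -> A (x / n.+1%:R) := h0' _ HA.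
  by apply: (@filterS _ \oo) => n; apply; apply: mulf_neq0 => //; rewrite invr_eq0 pnatr_eq0.
have hsin : (x / n.+1%:R)^-1 * sin (x / n.+1%:R) @[n --> \oo] --> (1 : R).
  exact: (cvg_comp (fun n : nat => x / n.+1%:R) _ h0 sin'0).
rewrite -[X in _ --> X](mulr1 x).
under eq_fun => n.
  have -> : n.+1%:R * sin (x / n.+1%:R) = x * ((x / n.+1%:R)^-1 * sin (x / n.+1%:R)).
    by rewrite invf_div mulrA mulrCA divff// mulr1.
  over.
by apply: cvgM => //; exact: cvg_cst.
Qed.

Lemma pow_cvg_expR u x : n.+1%:R * u n @[n --> \oo] --> x ->
  (1 + u n) ^+ n.+1 @[n --> \oo] --> expR x.
Proof.
move=> nux.
have u0 : u n @[n --> \oo] --> 0.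
  rewrite -(mul0r x); under eq_fun => n.
    have -> : u n = n.+1%:R^-1 * (n.+1%:R * u n) by rewrite mulKf// pnatr_eq0.
    over.
  by apply: cvgM => //; exact: cvg_harmonic.
have u1 : \forall n \near \oo, `|u n| < 1.
  by move/cvgr0Pnorm_lt : u0; apply.
have lncvg : n.+1%:R * ln (1 + u n) @[n --> \oo] --> x.
  apply: (@squeeze_cvgr _ _ _ _ (fun n => n.+1%:R * u n / (1 + u n)) (fun n => n.+1%:R * u n)).
  - near=> n.
    have /ltr_normlP[uN1 uN2] : `|u n| < 1 by near: n.
    have u10 : 0 < 1 + u n by lra.
    rewrite -mulrA !ler_pM2l ?ltr0n// le_ln1Dx ?andbT; last by lra.
    rewrite -[leRHS]opprK -lnV ?posrE// lerNr.
    rewrite [X in ln X](_ : _ = 1 + - (u n / (1 + u n))); last by field; lra.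
    apply: le_ln1Dx; rewrite ltrN2 ltr_pdivrMr//; lra.
  - rewrite -[X in _ --> X]mulr1; apply: cvgM => //.
    rewrite -[X in _ --> X]invr1; apply: cvgV; first by rewrite oner_neq0.
    by rewrite -[X in _ --> X]addr0; apply: cvgD => //; exact: cvg_cst.
  - exact: nux.
have : expR (n.+1%:R * ln (1 + u n)) @[n --> \oo] --> expR x.
  by apply: continuous_cvg => //; exact: continuous_expR.
apply: cvg_trans; apply: near_eq_cvg; near=> n.
have /ltr_normlP[uN1 uN2] : `|u n| < 1 by near: n.
by rewrite expRM_natl lnK// posrE; lra.
Unshelve. all: by end_near. Qed.
End exp_of_sine.

Section bounded_integrable.
Context {R : realType} d (T : measurableType d) (P : probability T R).

Lemma bounded_integrable (G : T -> R) (C : R) : measurable_fun setT G ->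
  (forall w, `|G w| <= C) -> P.-integrable setT (EFin \o G).
Proof.
move=> mG GC; apply: measurable_bounded_integrable => //.
  by rewrite [X in (X < _)%E]probability_setT ltry.
exists C; split; first exact: num_real.
by move=> M CM w _; exact: le_trans (GC w) (ltW CM).
Qed.

End bounded_integrable.

Section same_mean.
Context {R : realType} d1 d2 (T1 : measurableType d1) (T2 : measurableType d2)
  (P1 : probability T1 R) (P2 : probability T2 R).

Definition same_mean (G1 : T1 -> R) (G2 : T2 -> R) :=
  [/\ P1.-integrable setT (EFin \o G1), P2.-integrable setT (EFin \o G2) &
   (\int[P1]_w (G1 w)%:E = \int[P2]_w (G2 w)%:E)%E].

Lemma same_meanD F1 F2 G1 G2 : same_mean F1 F2 -> same_mean G1 G2 ->
  same_mean (F1 \+ G1) (F2 \+ G2).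
Proof.
move=> [iF1 iF2 F12] [iG1 iG2 G12]; split.
- exact: (integrableD measurableT iF1 iG1).
- exact: (integrableD measurableT iF2 iG2).
transitivity (\int[P1]_w ((F1 w)%:E + (G1 w)%:E))%E; first exact: eq_integral.
transitivity (\int[P2]_w ((F2 w)%:E + (G2 w)%:E))%E; last exact: eq_integral.
by rewrite !integralD// F12 G12.
Qed.

Lemma same_meanZ (k : R) G1 G2 : same_mean G1 G2 ->
  same_mean (fun w => k * G1 w) (fun w => k * G2 w).
Proof.
move=> [iG1 iG2 G12]; split.
- exact: (integrableZl measurableT k iG1).
- exact: (integrableZl measurableT k iG2).
transitivity (\int[P1]_w (k%:E * (G1 w)%:E))%E; first exact: eq_integral.
transitivity (\int[P2]_w (k%:E * (G2 w)%:E))%E; last exact: eq_integral.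
by rewrite !integralZl// G12.
Qed.

Lemma same_mean_cst (k : R) : same_mean (cst k) (cst k).
Proof.
split; [exact: finite_measure_integrable_cst|exact: finite_measure_integrable_cst|].
by rewrite /= !integral_probability_cst.
Qed.

Lemma eq_same_mean F1 F2 G1 G2 : F1 =1 G1 -> F2 =1 G2 ->
  same_mean F1 F2 -> same_mean G1 G2.
Proof. by move=> /funext <- /funext <-. Qed.

End same_mean.

Section linear_forms.
Context {R : realType} (Y T : Type).

Definition linear_form (X : Y -> T -> R) (s : seq (R * Y)) (w : T) : R :=
  \sum_(p <- s) p.1 * X p.2 w.

Lemma linear_form_cons X p s w :
  linear_form X (p :: s) w = p.1 * X p.2 w + linear_form X s w.
Proof. by rewrite /linear_form big_cons. Qed.

End linear_forms.

Section trigonometric_moments.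
Context {R : realType} dY (Y : measurableType dY)
  d1 d2 (T1 : measurableType d1) (T2 : measurableType d2)
  (P1 : probability T1 R) (P2 : probability T2 R).
Variables (X1 : Y -> T1 -> R) (X2 : Y -> T2 -> R).
Hypothesis mX1 : forall y, measurable_fun setT (X1 y).
Hypothesis mX2 : forall y, measurable_fun setT (X2 y).
Hypothesis X12 : forall (s : seq (R * Y)) (h : R -> \bar R),
  measurable_fun setT h -> (forall x, 0 <= h x)%E ->
  (\int[P1]_w h (linear_form X1 s w) = \int[P2]_w h (linear_form X2 s w))%E.

Lemma measurable_linear_form d (T : measurableType d) (X : Y -> T -> R) s :
  (forall y, measurable_fun setT (X y)) -> measurable_fun setT (linear_form X s).
Proof.
move=> mX; rewrite /linear_form; elim: s => [|p s IH].
  by under eq_fun do rewrite big_nil; exact: measurable_cst.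
under eq_fun do rewrite big_cons.
by apply: measurable_funD => //; exact: measurable_funM.
Qed.

Lemma same_mean_bounded (h : R -> R) s : measurable_fun setT h ->
  (forall x, `|h x| <= 1) ->
  same_mean P1 P2 (h \o linear_form X1 s) (h \o linear_form X2 s).
Proof.
move=> mh h1.
have mL1 := measurable_linear_form s mX1; have mL2 := measurable_linear_form s mX2.
have i1 : P1.-integrable setT (EFin \o (h \o linear_form X1 s)).
  by apply: (@bounded_integrable _ _ _ _ _ 1) => [|w]; [exact: measurableT_comp|exact: h1].
have i2 : P2.-integrable setT (EFin \o (h \o linear_form X2 s)).
  by apply: (@bounded_integrable _ _ _ _ _ 1) => [|w]; [exact: measurableT_comp|exact: h1].
have h' : same_mean P1 P2 (cst 1 \+ (h \o linear_form X1 s)) (cst 1 \+ (h \o linear_form X2 s)).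
  split.
  - apply: (@bounded_integrable _ _ _ _ _ (1 + 1)) => [|w /=].
      by apply: measurable_funD => //; exact: measurableT_comp.
    by rewrite (le_trans (ler_normD _ _))// normr1 lerD2l.
  - apply: (@bounded_integrable _ _ _ _ _ (1 + 1)) => [|w /=].
      by apply: measurable_funD => //; exact: measurableT_comp.
    by rewrite (le_trans (ler_normD _ _))// normr1 lerD2l.
  - apply: (X12 s (h := fun x => (1 + h x)%:E)) => [|x].
      by apply/measurable_EFinP; exact: measurable_funD.
    by rewrite lee_fin; have /ler_normlP[] := h1 x; lra.
have := same_meanD h' (same_mean_cst P1 P2 (-1)).
by apply: eq_same_mean => w /=; lra.
Qed.

(** Product-to-sum formulas: multiplying by [1 + g sin(k X_y)] replaces the
    cosine of a linear form by a combination of a cosine and of sines of linear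
    forms with one more term, and similarly for sines. The induction therefore
    carries an arbitrary cosine or sine factor along. *)
Lemma same_mean_sine_product (g k : R) (l : seq Y) :
  same_mean P1 P2 (fun w => \prod_(y <- l) (1 + g * sin (k * X1 y w)))
                  (fun w => \prod_(y <- l) (1 + g * sin (k * X2 y w))).
Proof.
pose Q T (X : Y -> T -> R) (l : seq Y) w := \prod_(y <- l) (1 + g * sin (k * X y w)).
suff H : forall s,
  same_mean P1 P2 (fun w => Q _ X1 l w * cos (linear_form X1 s w))
                  (fun w => Q _ X2 l w * cos (linear_form X2 s w)) /\
  same_mean P1 P2 (fun w => Q _ X1 l w * sin (linear_form X1 s w))
                  (fun w => Q _ X2 l w * sin (linear_form X2 s w)).
  have [+ _] := H [::].
  by apply: eq_same_mean => w; rewrite /linear_form big_nil cos0 mulr1.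
elim: l => [|y l IH] s.
  split.
    have := same_mean_bounded s (continuous_measurable_fun (@continuous_cos R)) (@cos_max R).
    by apply: eq_same_mean => w /=; rewrite /Q big_nil mul1r.
  have := same_mean_bounded s (continuous_measurable_fun (@continuous_sin R)) (@sin_max R).
  by apply: eq_same_mean => w /=; rewrite /Q big_nil mul1r.
have [c0 s0] := IH s; have [cp sp] := IH ((k, y) :: s).
have [cm sm] := IH ((- k, y) :: s).
have e T (X : Y -> T -> R) w : Q _ X (y :: l) w = (1 + g * sin (k * X y w)) * Q _ X l w.
  by rewrite /Q big_cons.
split.
  have := same_meanD c0 (same_meanD (same_meanZ (g / 2) sp) (same_meanZ (- (g / 2)) sm)).
  by apply: eq_same_mean => w /=; rewrite e !linear_form_cons/= [- k * _]mulNr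
    !sinD sinN cosN; field.
have := same_meanD s0 (same_meanD (same_meanZ (g / 2) cm) (same_meanZ (- (g / 2)) cp)).
by apply: eq_same_mean => w /=; rewrite e !linear_form_cons/= [- k * _]mulNr
  !cosD sinN cosN; field.
Qed.

End trigonometric_moments.

Section weighted_mass.
Context {R : realType} dY (Y : measurableType dY)
  (mu : {sigma_finite_measure set Y -> \bar R})
  d (T : measurableType d) (P : probability T R) (X : Y -> T -> R).
Hypothesis mX : measurable_fun setT (fun p : Y * T => X p.1 p.2).
Variable w : Y -> R.
Hypotheses (mw : measurable_fun setT w) (w0 : forall y, 0 <= w y)
  (wfin : (\int[mu]_y (w y)%:E < +oo)%E).
Variables (f : R -> R) (B : R).
Hypotheses (mf : measurable_fun setT f) (f0 : forall x, 0 <= f x)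
  (fB : forall x, f x <= B).

Lemma measurable_process y : measurable_fun setT (X y).
Proof.
exact: (measurableT_comp mX (measurable_pair1 y)).
Qed.

Lemma measurable_process_path t : measurable_fun setT (X ^~ t).
Proof.
exact: (measurableT_comp mX (measurable_pair2 t)).
Qed.

Definition weighted_mass (t : T) : R := fine (\int[mu]_y (w y * f (X y t))%:E)%E.

Let B0 : 0 <= B. Proof. exact: le_trans (f0 0) (fB 0). Qed.

Let measurable_wf : measurable_fun setT (fun p : Y * T => (w p.1 * f (X p.1 p.2))%:E).
Proof.
apply/measurable_EFinP; apply: measurable_funM; first exact: measurableT_comp.
exact: measurableT_comp.
Qed.

Let wf_le t : (\int[mu]_y (w y * f (X y t))%:E <=
  B%:E * \int[mu]_y (w y)%:E)%E.
Proof.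
rewrite -ge0_integralZl//; last 2 first.
- exact/measurable_EFinP.
- by move=> y _; rewrite lee_fin.
apply: ge0_le_integral => //.
- by move=> y _; rewrite lee_fin mulr_ge0.
- apply/measurable_EFinP; apply: measurable_funM => //.
  by apply: measurableT_comp => //; exact: measurable_process_path.
- by apply/measurable_EFinP; exact: measurable_funM.
- by move=> y _; rewrite -EFinM lee_fin mulrC ler_wpM2r.
Qed.

Lemma weighted_massE t : (weighted_mass t)%:E = (\int[mu]_y (w y * f (X y t))%:E)%E.
Proof.
rewrite /weighted_mass fineK// ge0_fin_numE; last first.
  by apply: integral_ge0 => y _; rewrite lee_fin mulr_ge0.
by apply: le_lt_trans (wf_le t) _; rewrite lte_mul_pinfty// lee_fin.
Qed.

Lemma weighted_mass_ge0 t : 0 <= weighted_mass t.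
Proof. by rewrite fine_ge0// integral_ge0// => y _; rewrite lee_fin mulr_ge0. Qed.

Definition weighted_mass_bound : R := B * fine (\int[mu]_y (w y)%:E)%E.

Lemma weighted_mass_le t : weighted_mass t <= weighted_mass_bound.
Proof.
rewrite -lee_fin weighted_massE /weighted_mass_bound EFinM fineK ?wf_le//.
by rewrite ge0_fin_numE// integral_ge0// => y _; rewrite lee_fin.
Qed.

Lemma measurable_weighted_mass : measurable_fun setT weighted_mass.
Proof.
apply/measurable_EFinP.
rewrite (_ : EFin \o _ = fun t => (\int[mu]_y (w y * f (X y t))%:E)%E); last first.
  by apply/funext => t; rewrite /= weighted_massE.
apply: (@measurable_fun_fubini_tonelli_G _ _ _ _ _ mu
  (fun p => (w p.1 * f (X p.1 p.2))%:E)) => // p.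
by rewrite lee_fin mulr_ge0.
Qed.

Definition value_product (l : seq Y) (t : T) : R := \prod_(y <- l) f (X y t).

Lemma value_product_ge0 l t : 0 <= value_product l t.
Proof. by rewrite /value_product prodr_ge0. Qed.

Lemma measurable_value_product l : measurable_fun setT (value_product l).
Proof.
rewrite /value_product; elim: l => [|y l IH].
  by under eq_fun do rewrite big_nil; exact: measurable_cst.
under eq_fun do rewrite big_cons.
apply: measurable_funM => //; apply: measurableT_comp => //.
exact: measurable_process.
Qed.

Lemma value_product_le l t : value_product l t <= B ^+ size l.
Proof.
rewrite /value_product; elim: l => [|y l IH]; first by rewrite big_nil.
by rewrite big_cons exprS ler_pM// prodr_ge0.
Qed.

Lemma measurable_mass_product k l :
  measurable_fun setT (fun t => weighted_mass t ^+ k * value_product l t).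
Proof.
apply: measurable_funM; last exact: measurable_value_product.
by apply: measurable_funX; exact: measurable_weighted_mass.
Qed.

Lemma integrable_mass_product k l :
  P.-integrable setT (EFin \o (fun t => weighted_mass t ^+ k * value_product l t)).
Proof.
apply: (@bounded_integrable _ _ _ _ _ (weighted_mass_bound ^+ k * B ^+ size l)).
  exact: measurable_mass_product.
move=> t; rewrite ger0_norm; last first.
  by rewrite mulr_ge0 ?exprn_ge0 ?weighted_mass_ge0 ?value_product_ge0.
rewrite ler_pM ?exprn_ge0 ?weighted_mass_ge0 ?value_product_ge0 ?value_product_le//.
rewrite lerXn2r ?nnegrE ?weighted_mass_ge0 ?weighted_mass_le//.
exact: le_trans (weighted_mass_ge0 t) (weighted_mass_le t).
Qed.

(** Fubini trades one power of the mass for one more point in the product of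
    values, so that all moments of the mass reduce to finite products. *)
Lemma mean_mass_productS k l :
  (\int[P]_t (weighted_mass t ^+ k.+1 * value_product l t)%:E =
   \int[mu]_y ((w y)%:E *
     \int[P]_t (weighted_mass t ^+ k * value_product (y :: l) t)%:E))%E.
Proof.
pose G t := weighted_mass t ^+ k * value_product l t.
have G0 t : 0 <= G t.
  by rewrite mulr_ge0 ?exprn_ge0 ?weighted_mass_ge0 ?value_product_ge0.
have mG : measurable_fun setT G by exact: measurable_mass_product.
transitivity (\int[P]_t \int[mu]_y (w y * f (X y t) * G t)%:E)%E.
  apply: eq_integral => t _.
  under [RHS]eq_integral do rewrite EFinM.
  rewrite ge0_integralZr//.
  - by rewrite -weighted_massE -EFinM exprS mulrA.
  - apply/measurable_EFinP; apply: measurable_funM => //.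
    by apply: measurableT_comp => //; exact: measurable_process_path.
  - by move=> y _; rewrite lee_fin mulr_ge0.
  - by rewrite lee_fin.
rewrite -(@fubini_tonelli _ _ _ _ _ mu P (fun p => (w p.1 * f (X p.1 p.2) * G p.2)%:E))/=; last 2 first.
- apply/measurable_EFinP; apply: measurable_funM; last exact: measurableT_comp.
  by apply/measurable_EFinP.
- by move=> p; rewrite lee_fin mulr_ge0// mulr_ge0.
apply: eq_integral => y _.
rewrite -ge0_integralZl//.
- apply: eq_integral => t _; rewrite -EFinM /G /value_product big_cons.
  by congr EFin; ring.
- by apply/measurable_EFinP; exact: measurable_mass_product.
- move=> t _; rewrite lee_fin mulr_ge0 ?exprn_ge0 ?weighted_mass_ge0//.
  exact: value_product_ge0.
- by rewrite lee_fin.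
Qed.

(** The polynomials [(1 - t M / n)^n] converge boundedly to [exp(- t M)] because
    [M] is bounded; they reduce Laplace transforms to moments. *)
Lemma expR_mass_cvg (t : R) : 0 <= t ->
  (\int[P]_x ((1 - t / n.+1%:R * weighted_mass x) ^+ n.+1)%:E @[n --> \oo]
   --> \int[P]_x (expR (- (t * weighted_mass x)))%:E)%E.
Proof.
move=> t0.
have mM := measurable_weighted_mass.
have [|||||_ _ //] := @dominated_convergence _ _ _ P setT measurableT
  (fun n x => ((1 - t / n.+1%:R * weighted_mass x) ^+ n.+1)%:E)
  (fun x => (expR (- (t * weighted_mass x)))%:E)
  (cst (expR (t * weighted_mass_bound))%:E).
- move=> n; apply/measurable_EFinP; apply: measurable_funX.
  by apply: measurable_funB => //; exact: measurable_funM.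
- apply/measurable_EFinP; apply: measurableT_comp => //.
  by apply: measurableT_comp => //; exact: measurable_funM.
- apply: aeW => x _; apply: cvg_EFin.
    by near=> n.
  apply: (@pow_cvg_expR _ (fun n => - (t / n.+1%:R * weighted_mass x))).
  rewrite (_ : (fun n => _) = cst (- (t * weighted_mass x))); first exact: cvg_cst.
  by apply/funext => n /=; field; rewrite addrC natr1 pnatr_eq0.
- exact: finite_measure_integrable_cst.
- apply: aeW => x n _; rewrite lee_fin normrX.
  apply: (@le_trans _ _ (expR (t / n.+1%:R * weighted_mass x) ^+ n.+1)).
    rewrite lerXn2r ?nnegrE ?expR_ge0// ler_norml.
    have h : 0 <= t / n.+1%:R * weighted_mass x.
      by rewrite !mulr_ge0 ?invr_ge0 ?weighted_mass_ge0.
    have := expR_ge1Dx (t / n.+1%:R * weighted_mass x).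
    by move: (expR _) h => e h; set u := _ * _ in h *; lra.
  rewrite -expRM_natl ler_expR.
  rewrite (_ : _ * _ = t * weighted_mass x).
    by rewrite ler_wpM2l// weighted_mass_le.
  by field; rewrite addrC natr1 pnatr_eq0.
Unshelve. all: by end_near. Qed.

End weighted_mass.

Section sine_exp.
Context {R : realType}.
Implicit Types (g x : R) (n : nat).

(** A bounded, nonnegative approximation of [exp(g x)]. Expectations of products
    of its values are trigonometric polynomials in finitely many linear forms, and
    the even exponent makes it nonnegative. *)
Definition sine_exp g n x : R :=
  (1 + g * sin (n.+1%:R^-1 / 2 * x)) ^+ (n.+1 * 2).

Lemma sine_exp_ge0 g n x : 0 <= sine_exp g n x.
Proof. by rewrite /sine_exp exprM sqr_ge0. Qed.

Lemma normr_sine_factor g x : 0 <= g -> `|1 + g * sin x| <= 1 + g * `|sin x|.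
Proof.
by move=> g0; rewrite (le_trans (ler_normD _ _))// normr1 normrM (ger0_norm g0).
Qed.

Lemma sine_exp_bounded g n x : 0 <= g -> sine_exp g n x <= (1 + g) ^+ (n.+1 * 2).
Proof.
move=> g0; rewrite -[leLHS]ger0_norm ?sine_exp_ge0// normrX.
rewrite lerXn2r ?nnegrE ?addr_ge0// (le_trans (normr_sine_factor _ g0))//.
by rewrite lerD2l -[leRHS]mulr1 ler_wpM2l// sin_max.
Qed.

(** Domination uniform in [n], from [|sin u| <= |u|] and [1 + v <= exp v]. *)
Lemma sine_exp_le_expR g n x : 0 <= g -> sine_exp g n x <= expR (g * `|x|).
Proof.
move=> g0; rewrite -[leLHS]ger0_norm ?sine_exp_ge0// normrX.
set u := _ / _ * _.
have : `|1 + g * sin u| <= expR (g * `|u|).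
  rewrite (le_trans (normr_sine_factor _ g0))// (le_trans _ (expR_ge1Dx _))//.
  by rewrite lerD2l ler_wpM2l// normr_sin_le.
move=> /(lerXn2r (n.+1 * 2)); rewrite !nnegrE expR_ge0 => /(_ (normr_ge0 _) isT) /le_trans; apply.
rewrite -expRM_natl ler_expR /u normrM ger0_norm ?divr_ge0 ?invr_ge0//.
rewrite le_eqVlt; apply/orP; left; apply/eqP; rewrite natrM; field.
by rewrite addrC natr1 pnatr_eq0.
Qed.

Lemma measurable_sine_exp g n : measurable_fun setT (sine_exp g n).
Proof.
apply: measurable_funX; apply: measurable_funD => //; apply: measurable_funM => //.
apply: measurableT_comp; last exact: measurable_funM.
exact: continuous_measurable_fun (@continuous_sin R).
Qed.

Lemma sine_exp_cvg g x : sine_exp g n x @[n --> \oo] --> expR (g * x).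
Proof.
have h : (1 + g * sin (n.+1%:R^-1 / 2 * x)) ^+ n.+1 @[n --> \oo] --> expR (g * (x / 2)).
  apply: pow_cvg_expR.
  have : g * (n.+1%:R * sin (x / 2 / n.+1%:R)) @[n --> \oo] --> g * (x / 2).
    by apply: cvgM; [exact: cvg_cst|exact: cvg_natmul_sin].
  apply: cvg_trans.
  apply: near_eq_cvg; near=> n => /=; rewrite mulrCA; congr (_ * (_ * sin _)).
  by field; rewrite addrC natr1 pnatr_eq0.
rewrite (_ : expR (g * x) = expR (g * (x / 2)) ^+ 2); last first.
  by rewrite -expRM_natl; congr expR; field.
under eq_fun do rewrite /sine_exp exprM.
by rewrite expr2; under eq_fun do rewrite expr2; exact: cvgM.
Unshelve. all: by end_near. Qed.

End sine_exp.

Section laplace_bounded.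
Context {R : realType} dY (Y : measurableType dY)
  (mu : {sigma_finite_measure set Y -> \bar R})
  d1 d2 (T1 : measurableType d1) (T2 : measurableType d2)
  (P1 : probability T1 R) (P2 : probability T2 R).
Variables (X1 : Y -> T1 -> R) (X2 : Y -> T2 -> R).
Hypothesis mX1 : measurable_fun setT (fun p : Y * T1 => X1 p.1 p.2).
Hypothesis mX2 : measurable_fun setT (fun p : Y * T2 => X2 p.1 p.2).
Variable w : Y -> R.
Hypotheses (mw : measurable_fun setT w) (w0 : forall y, 0 <= w y)
  (wfin : (\int[mu]_y (w y)%:E < +oo)%E).
Variables (f : R -> R) (B : R).
Hypotheses (mf : measurable_fun setT f) (f0 : forall x, 0 <= f x)
  (fB : forall x, f x <= B).
Hypothesis f12 : forall l : seq Y,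
  same_mean P1 P2 (value_product X1 f l) (value_product X2 f l).
Local Notation M1 := (weighted_mass mu X1 w f).
Local Notation M2 := (weighted_mass mu X2 w f).

Lemma same_mean_mass_product k l : same_mean P1 P2
  (fun t => M1 t ^+ k * value_product X1 f l t)
  (fun t => M2 t ^+ k * value_product X2 f l t).
Proof.
split.
- exact: (integrable_mass_product P1 mX1 mw w0 wfin mf f0 fB k l).
- exact: (integrable_mass_product P2 mX2 mw w0 wfin mf f0 fB k l).
elim: k l => [|k IH] l.
  have [_ _ e] := f12 l.
  by under eq_integral do rewrite expr0 mul1r; rewrite e;
     under [RHS]eq_integral do rewrite expr0 mul1r.
rewrite (mean_mass_productS P1 mX1 mw w0 wfin mf f0 fB).
rewrite (mean_mass_productS P2 mX2 mw w0 wfin mf f0 fB).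
by apply: eq_integral => y _; rewrite IH.
Qed.

Lemma same_mean_mass_poly s k j : same_mean P1 P2
  (fun t => (1 - s * M1 t) ^+ k * M1 t ^+ j)
  (fun t => (1 - s * M2 t) ^+ k * M2 t ^+ j).
Proof.
elim: k j => [|k IH] j.
  have := same_mean_mass_product j [::].
  by apply: eq_same_mean => t; rewrite /value_product big_nil expr0 mulr1 mul1r.
have := same_meanD (IH j) (same_meanZ (- s) (IH j.+1)).
by apply: eq_same_mean => t /=; rewrite !exprS; ring.
Qed.

Lemma laplace_bounded_eq (t : R) : 0 <= t ->
  (\int[P1]_x (expR (- (t * M1 x)))%:E = \int[P2]_x (expR (- (t * M2 x)))%:E)%E.
Proof.
move=> t0.
have c1 := @expR_mass_cvg _ _ _ mu _ _ P1 X1 mX1 w mw w0 wfin f B mf f0 fB t t0.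
have c2 := @expR_mass_cvg _ _ _ mu _ _ P2 X2 mX2 w mw w0 wfin f B mf f0 fB t t0.
apply: (cvg_unique _ c1); first exact: ereal_hausdorff.
apply: cvg_trans c2; apply: near_eq_cvg; near=> n.
have [_ _ ] := same_mean_mass_poly (t / n.+1%:R) n.+1 0.
under eq_integral do rewrite expr0 mulr1.
by move=> ->; apply: eq_integral => x _; rewrite expr0 mulr1.
Unshelve. all: by end_near. Qed.

End laplace_bounded.

Lemma measurable_expeRN {R : realType} d (T : measurableType d) (h : T -> \bar R) :
  measurable_fun setT h -> (forall x, 0 <= h x)%E ->
  measurable_fun setT (fun x => expeR (- h x)).
Proof.
move=> mh h0.
rewrite (_ : (fun x => _) = fun x => if h x == +oo%E then 0%E
    else (expR (- fine (h x)))%:E); last first.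
  by apply/funext => x; have := h0 x; case: (h x).
apply: measurable_fun_ifT => //.
  rewrite (_ : (fun x => h x == +oo%E) = fun x => (+oo <= h x)%E).
    exact: measurable_fun_lee.
  by apply/funext => x; rewrite leye_eq.
apply/measurable_EFinP; apply: measurableT_comp => //; apply: measurableT_comp => //.
by apply: measurableT_comp => //; exact: fine_measurable.
Qed.

Section laplace_exponential_mass.
Context {R : realType} dY (Y : measurableType dY)
  (mu : {sigma_finite_measure set Y -> \bar R})
  d (T : measurableType d) (P : probability T R) (X : Y -> T -> R).
Hypothesis mX : measurable_fun setT (fun p : Y * T => X p.1 p.2).
Variables (w : Y -> R) (g : R).
Hypotheses (mw : measurable_fun setT w) (w0 : forall y, 0 <= w y)
  (wfin : (\int[mu]_y (w y)%:E < +oo)%E) (g0 : 0 <= g).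
Hypothesis expfin : (\int[mu]_y ((w y)%:E *
  \int[P]_x (expR (g * `|X y x|))%:E) < +oo)%E.

Definition exponential_mass (x : T) : \bar R :=
  (\int[mu]_y (w y * expR (g * X y x))%:E)%E.

Lemma exponential_mass_ge0 x : (0 <= exponential_mass x)%E.
Proof. by apply: integral_ge0 => y _; rewrite lee_fin mulr_ge0 ?expR_ge0. Qed.

Lemma measurable_exponential_mass : measurable_fun setT exponential_mass.
Proof.
apply: (@measurable_fun_fubini_tonelli_G _ _ _ _ _ mu
  (fun p => (w p.1 * expR (g * X p.1 p.2))%:E)) => [|p].
  apply/measurable_EFinP; apply: measurable_funM; first exact: measurableT_comp.
  by apply: measurableT_comp => //; exact: measurable_funM.
by rewrite lee_fin mulr_ge0 ?expR_ge0.
Qed.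

Let dominating (p : Y * T) : \bar R := (w p.1 * expR (g * `|X p.1 p.2|))%:E.

Let measurable_dominating : measurable_fun setT dominating.
Proof.
apply/measurable_EFinP; apply: measurable_funM; first exact: measurableT_comp.
apply: measurableT_comp => //; apply: measurable_funM => //.
exact: measurableT_comp.
Qed.

Let ae_dominated : {ae P, forall x, mu.-integrable setT (fun y => dominating (y, x))}.
Proof.
have [/= _ h] := @integrable12ltyP _ _ _ _ _ mu P _ measurable_dominating.
apply: (@ae_integrable2 _ _ _ _ _ mu P dominating); apply: h.
apply: le_lt_trans expfin; rewrite le_eqVlt; apply/orP; left; apply/eqP.
apply: eq_integral => y _; rewrite -ge0_integralZl//.
- apply: eq_integral => x _; rewrite ger0_norm ?EFinM//.
  by rewrite mulr_ge0 ?expR_ge0.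
- apply/measurable_EFinP; apply: measurableT_comp => //; apply: measurable_funM => //.
  by apply: measurableT_comp => //; exact: (measurable_process mX).
- by rewrite lee_fin.
Qed.

(** Two nested dominated convergences. For almost every path [exp(g |X_y|)] is
    integrable in [y], by Fubini and the finiteness of its mean; it dominates
    the approximations, and the outer integrand is at most 1. *)
Lemma laplace_sine_exp_cvg (t : R) : 0 <= t ->
  (\int[P]_x (expR (- (t * weighted_mass mu X w (sine_exp g n) x)))%:E @[n --> \oo]
   --> \int[P]_x expeR (- (t%:E * exponential_mass x)))%E.
Proof.
move=> t0.
have sb n x : sine_exp g n x <= (1 + g) ^+ (n.+1 * 2) by exact: sine_exp_bounded.
have mM n := measurable_weighted_mass mX mw w0 wfin (measurable_sine_exp g n)
  (sine_exp_ge0 g n) (sb n).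
have ME n x := @weighted_massE _ _ _ mu _ _ X mX w mw w0 wfin _ _ (measurable_sine_exp g n)
  (sine_exp_ge0 g n) (sb n) x.
have M0 n x := @weighted_mass_ge0 _ _ _ mu _ _ X w w0 _ (sine_exp_ge0 g n) x.
have [|||||_ _ //] := @dominated_convergence _ _ _ P setT measurableT
  (fun n x => (expR (- (t * weighted_mass mu X w (sine_exp g n) x)))%:E)
  (fun x => expeR (- (t%:E * exponential_mass x)))%E (cst 1%E).
- move=> n; apply/measurable_EFinP; apply: measurableT_comp => //.
  by apply: measurableT_comp => //; exact: measurable_funM.
- apply: measurable_expeRN.
    by apply: emeasurable_funM => //; exact: measurable_exponential_mass.
  by move=> x; rewrite mule_ge0 ?lee_fin ?exponential_mass_ge0.
- apply: filterS ae_dominated => x ix _.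
  have mXx := measurable_process_path mX x.
  have [|||||ie _ cJ] := @dominated_convergence _ _ _ mu setT measurableT
    (fun n y => (w y * sine_exp g n (X y x))%:E)
    (fun y => (w y * expR (g * X y x))%:E) (fun y => dominating (y, x)).
  + move=> n; apply/measurable_EFinP; apply: measurable_funM => //.
    by apply: measurableT_comp => //; exact: measurable_sine_exp.
  + apply/measurable_EFinP; apply: measurable_funM => //.
    by apply: measurableT_comp => //; exact: measurable_funM.
  + apply: aeW => y _; apply: cvg_EFin; first by near=> n.
    by apply: cvgM; [exact: cvg_cst|exact: sine_exp_cvg].
  + exact: ix.
  + apply: aeW => y n _; rewrite lee_fin /= normrM (ger0_norm (w0 y)) (ger0_norm (sine_exp_ge0 _ _ _)).
    by rewrite ler_wpM2l// sine_exp_le_expR.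
  have efin : exponential_mass x \is a fin_num by exact: integrable_fin_num ie.
  rewrite -(fineK efin) -EFinM /=; apply: cvg_EFin; first by near=> n.
  apply: (@continuous_cvg _ _ _ _ _ _ (fun s => expR (- (t * s)))).
    by move=> s; apply: continuous_comp; [apply: continuousN; apply: mulrl_continuous|
      exact: continuous_expR].
  by apply: fine_cvg; rewrite fineK.
- exact: (finite_measure_integrable_cst P 1).
- apply: aeW => x n _; rewrite lee_fin ger0_norm ?expR_ge0// -expR0 ler_expR.
  by rewrite oppr_le0 mulr_ge0.
Unshelve. all: by end_near. Qed.

End laplace_exponential_mass.

Section laplace_determined.
Context {R : realType} dY (Y : measurableType dY)
  (mu : {sigma_finite_measure set Y -> \bar R})
  d1 d2 (T1 : measurableType d1) (T2 : measurableType d2)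
  (P1 : probability T1 R) (P2 : probability T2 R).
Variables (X1 : Y -> T1 -> R) (X2 : Y -> T2 -> R).
Hypothesis mX1 : measurable_fun setT (fun p : Y * T1 => X1 p.1 p.2).
Hypothesis mX2 : measurable_fun setT (fun p : Y * T2 => X2 p.1 p.2).
Hypothesis X12 : forall (s : seq (R * Y)) (h : R -> \bar R),
  measurable_fun setT h -> (forall x, 0 <= h x)%E ->
  (\int[P1]_w h (linear_form X1 s w) = \int[P2]_w h (linear_form X2 s w))%E.
Variables (w : Y -> R) (g : R).
Hypotheses (mw : measurable_fun setT w) (w0 : forall y, 0 <= w y)
  (wfin : (\int[mu]_y (w y)%:E < +oo)%E) (g0 : 0 <= g).
Hypothesis expfin1 : (\int[mu]_y ((w y)%:E *
  \int[P1]_x (expR (g * `|X1 y x|))%:E) < +oo)%E.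
Hypothesis expfin2 : (\int[mu]_y ((w y)%:E *
  \int[P2]_x (expR (g * `|X2 y x|))%:E) < +oo)%E.

Lemma same_mean_sine_exp n l : same_mean P1 P2
  (value_product X1 (sine_exp g n) l) (value_product X2 (sine_exp g n) l).
Proof.
have := same_mean_sine_product (measurable_process mX1) (measurable_process mX2)
  X12 g (n.+1%:R^-1 / 2) (flatten [seq nseq (n.+1 * 2) y | y <- l]).
by apply: eq_same_mean => x; rewrite big_flatten big_map /value_product;
  apply: eq_bigr => y _; rewrite big_nseq iter_mulr_1.
Qed.

(** Two processes whose finite linear combinations have the same laws give the
    same Laplace transform to [int w(y) exp(g X_y) mu(dy)]. Only joint
    measurability is available, so the integral cannot be approximated by
    Riemann sums; it is reached through the moments of its bounded
    approximations. *)
Lemma laplace_exponential_mass_eq (t : R) : 0 <= t ->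
  (\int[P1]_x expeR (- (t%:E * exponential_mass mu X1 w g x)) =
   \int[P2]_x expeR (- (t%:E * exponential_mass mu X2 w g x)))%E.
Proof.
move=> t0.
have c1 := laplace_sine_exp_cvg mX1 mw w0 wfin g0 expfin1 t0.
have c2 := laplace_sine_exp_cvg mX2 mw w0 wfin g0 expfin2 t0.
apply: (cvg_unique _ c1); first exact: ereal_hausdorff.
apply: cvg_trans c2; apply: near_eq_cvg; near=> n.
apply/esym; apply: (laplace_bounded_eq mX1 mX2 mw w0 wfin (measurable_sine_exp g n)
  (sine_exp_ge0 g n) (fun x => sine_exp_bounded n x g0)) => // l.
exact: same_mean_sine_exp.
Unshelve. all: by end_near. Qed.

End laplace_determined.

(** * Scaling of Lebesgue measure *)

Section lebesgue_tuple_scaling.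
Context {R : realType}.
Local Notation mu1 := (@lebesgue_measure R).
Local Notation RM := (measurableTypeR R).

Definition scale_tuple d (r : R) (y : d.-tuple R) : d.-tuple R :=
  [tuple r * tnth y i | i < d].

Lemma measurable_scale_tuple d (r : R) : measurable_fun setT (@scale_tuple d r).
Proof.
apply/measurable_fun_tnthP => i.
rewrite (_ : _ \o _ = fun y => r * tnth y i); last first.
  by apply/funext => y /=; rewrite tnth_mktuple.
by apply: measurable_funM => //; exact: measurable_tnth.
Qed.

Lemma scale_tcons n (r : R) (a : R) (t : n.-tuple R) :
  scale_tuple r (tcons (a, t)) = tcons (r * a, scale_tuple r t).
Proof.
apply: eq_from_tnth => i; rewrite tnth_mktuple.
case: (unliftP ord0 i) => [j|] ->; last by rewrite !tnth0.
by rewrite !tnthS tnth_mktuple.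
Qed.

Lemma ge0_integral_lebesgue_tupleS n (f : n.+1.-tuple R -> \bar R) :
  measurable_fun setT f -> (forall x, 0 <= f x)%E ->
  (\int[lebesgue_tuple n.+1]_x f x =
   \int[mu1]_a \int[lebesgue_tuple n]_t f (tcons (a, t)))%E.
Proof.
move=> mf f0.
have := @ge0_integral_pushforward _ _ _ _ _ _ (@measurable_tcons R n)
  (mu1 \x lebesgue_tuple n)%E setT f.
rewrite preimage_setT /comp => h.
transitivity (\int[mu1 \x lebesgue_tuple n]_x f (tcons x))%E.
  by rewrite -h//; apply: eq_measure_integral.
rewrite (@fubini_tonelli1 _ _ _ _ _ mu1 (lebesgue_tuple n) (fun x => f (tcons x)))//.
exact: measurableT_comp (@measurable_tcons R n).
Qed.

Lemma integral_scale_tuple d (r : R) (f : d.-tuple R -> \bar R) : r != 0 ->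
  measurable_fun setT f -> (forall x, 0 <= f x)%E ->
  ((`|r| ^+ d)%:E * \int[lebesgue_tuple d]_y f (scale_tuple r y) =
   \int[lebesgue_tuple d]_x f x)%E.
Proof.
move=> r0; elim: d f => [|n IH] f mf f0.
  by rewrite expr0 mul1e; apply: eq_integral => y _; rewrite [scale_tuple _ _]tuple0 [y]tuple0.
have ms := @measurable_scale_tuple n.+1 r.
rewrite !ge0_integral_lebesgue_tupleS//; last exact: measurableT_comp mf ms.
have mfa a : measurable_fun setT (fun t => f (tcons (a, t))).
  exact: measurableT_comp (measurableT_comp mf (@measurable_tcons R n)) (measurable_pair1 a).
pose F a := (\int[lebesgue_tuple n]_t f (tcons (a, t)))%E.
have F0 a : (0 <= F a)%E by apply: integral_ge0.
have mF : measurable_fun [set: RM] F.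
  apply: (@measurable_fun_fubini_tonelli_F _ _ _ _ _ (lebesgue_tuple n) (fun x => f (tcons x))) => //.
  exact: measurableT_comp (@measurable_tcons R n).
rewrite -[RHS](integral_affine 0 r0)// -ge0_integralZl//; last 2 first.
- apply: (@measurable_fun_fubini_tonelli_F _ _ _ _ _ (lebesgue_tuple n)
    (fun x => f (scale_tuple r (tcons x)))) => //.
  exact: measurableT_comp (measurableT_comp mf ms) (@measurable_tcons R n).
- by move=> a _; apply: integral_ge0.
apply: eq_integral => a _; rewrite addr0 exprS EFinM -muleA; congr (_ * _)%E.
rewrite /F -[RHS]IH//; congr (_ * _)%E.
by apply: eq_integral => t _; rewrite scale_tcons.
Qed.

Lemma enorm_ge0 d (x : d.-tuple R) : 0 <= enorm x.
Proof. exact: sqrtr_ge0. Qed.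

Lemma enorm_scale d (r : R) (y : d.-tuple R) : enorm (scale_tuple r y) = `|r| * enorm y.
Proof.
rewrite /enorm -sqrtr_sqr -sqrtrM ?sqr_ge0// mulr_sumr; congr Num.sqrt.
by apply: eq_bigr => i _; rewrite tnth_mktuple exprMn.
Qed.

Lemma normr_tnth_le_enorm d (x : d.-tuple R) i : `|tnth x i| <= enorm x.
Proof.
rewrite /enorm -sqrtr_sqr ler_wsqrtr// (bigD1 i)//= lerDl.
by apply: sumr_ge0 => j _; exact: sqr_ge0.
Qed.

Lemma lebesgue_tuple_eball_fin d : (lebesgue_tuple d (eball d (1 : R)) < +oo)%E.
Proof.
pose A := fun i : 'I_d => (`]-1, 1[%classic : set R).
apply: (@le_lt_trans _ _ (lebesgue_tuple d [set x | forall i, A i (tnth x i)])).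
  apply: le_measure; rewrite ?inE; first exact: measurable_eball.
    rewrite (_ : mkset _ = \bigcap_(i in [set: 'I_d]) [set x | A i (tnth x i)]).
      apply: fin_bigcap_measurable => // i _.
      by rewrite -[X in measurable X]setTI; apply: measurable_tnth => //; exact: measurable_itv.
    by apply/seteqP; split=> x h i; [move=> _; exact: h|exact: h i Logic.I].
  move=> x; rewrite /eball/= => x1 i; rewrite /A/= in_itv/= -ltr_norml.
  exact: le_lt_trans (normr_tnth_le_enorm x i) x1.
rewrite lebesgue_tuple_box; last by move=> i; exact: measurable_itv.
rewrite (eq_bigr (fun=> (2%:E : \bar R))); last first.
  move=> i _; rewrite lebesgue_measure_itv/= lte_fin ifT; last by lra.
  by rewrite -EFinB opprK.
suff -> : (\prod_(i < d) 2%:E = (2 ^+ d)%:E :> \bar R)%E by exact: ltry.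
elim: {A} d => [|n IH]; first by rewrite big_ord0.
by rewrite big_ord_recl IH exprS EFinM.
Qed.

Lemma integral_eball_scale d (r rho : R) (f : d.-tuple R -> \bar R) : 0 < r ->
  measurable_fun (eball d (r * rho)) f -> (forall x, 0 <= f x)%E ->
  (\int[lebesgue_tuple d]_(x in eball d (r * rho)) f x =
   (r ^+ d)%:E * \int[lebesgue_tuple d]_(y in eball d rho) f (scale_tuple r y))%E.
Proof.
move=> r0 mf f0; rewrite integral_mkcond [in RHS]integral_mkcond.
rewrite -(@integral_scale_tuple d r)//; last 3 first.
- by rewrite gt_eqF.
- exact/(measurable_restrictT _ (measurable_eball d (r * rho))).
- by move=> x; rewrite patchE; case: ifP.
rewrite gtr0_norm//; congr (_ * _)%E; apply: eq_integral => y _.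
rewrite !patchE (_ : (scale_tuple r y \in eball d (r * rho)) = (y \in eball d rho))//.
by rewrite /eball; apply/idP/idP; rewrite !inE/= enorm_scale gtr0_norm// ltr_pM2l.
Qed.

End lebesgue_tuple_scaling.

(** * The logarithmic kernel *)

Section integral_restriction.
Local Open Scope ereal_scope.
Context {R : realType} d (T : measurableType d) (m : {finite_measure set T -> \bar R})
  (D : set T) (mD : measurable D).

Lemma ge0_integral_mrestr (f : T -> \bar R) :
  measurable_fun setT f -> (forall x, 0 <= f x) ->
  \int[mrestr m mD]_x f x = \int[m]_(x in D) f x.
Proof.
move=> mf f0.
rewrite (@ge0_negligible_integral _ _ _ (mrestr m mD) setT (~` D))//; last 2 first.
- exact: measurableC.
- by rewrite /= /mrestr setICl measure0.
rewrite setTD setCK; apply: eq_measure_integral => A mA AD.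
by rewrite /= /mrestr setIidl.
Qed.

Lemma integral_mrestr (f : T -> \bar R) : measurable_fun setT f ->
  \int[mrestr m mD]_x f x = \int[m]_(x in D) f x.
Proof.
move=> mf; rewrite integralE [RHS]integralE !ge0_integral_mrestr//.
- exact: measurable_funeneg.
- exact: measurable_funepos.
Qed.

End integral_restriction.

Lemma measurable_fun_integral_section {R : realType} d1 d2
    (T1 : measurableType d1) (T2 : measurableType d2)
    (m : {finite_measure set T2 -> \bar R}) (f : T1 -> T2 -> \bar R) :
  measurable_fun setT (fun p : T1 * T2 => f p.1 p.2) ->
  measurable_fun setT (fun x => \int[m]_y f x y)%E.
Proof.
move=> mf; pose F (p : T1 * T2) := f p.1 p.2.
under eq_fun do rewrite integralE; apply: emeasurable_funB.
- rewrite (_ : (fun x => _) = fubini_F m F^\+%E).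
    exact: (measurable_fun_fubini_tonelli_F _ (measurable_funepos mf)).
  by apply/funext => x; apply: eq_integral => y _; rewrite !funeposE.
- rewrite (_ : (fun x => _) = fubini_F m F^\-%E).
    exact: (measurable_fun_fubini_tonelli_F _ (measurable_funeneg mf)).
  by apply/funext => x; apply: eq_integral => y _; rewrite !funenegE.
Qed.

(** The integral is the difference of those of the positive and negative parts,
    so that the formula for nonnegative integrands extends to every measurable
    one, integrable or not. *)
Lemma integral_image_measure {R : realType} d1 d2
    (T1 : measurableType d1) (T2 : measurableType d2) (phi : T1 -> T2)
    (mphi : measurable_fun setT phi)
    (m : {measure set T1 -> \bar R}) (nu : {measure set T2 -> \bar R})
    (f : T2 -> \bar R) :
  (forall A, measurable A -> nu A = m (phi @^-1` A)) ->
  measurable_fun setT f -> (\int[nu]_x f x = \int[m]_y f (phi y))%E.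
Proof.
move=> nuE mf.
have h (g : T2 -> \bar R) : measurable_fun setT g -> (forall x, 0 <= g x)%E ->
    (\int[nu]_x g x = \int[m]_y g (phi y))%E.
  move=> mg g0.
  have := @ge0_integral_pushforward _ _ _ _ _ _ mphi m setT g.
  rewrite preimage_setT /comp => <-//.
  by apply: eq_measure_integral => A mA _; rewrite nuE.
rewrite integralE [RHS]integralE; congr (_ - _)%E.
- rewrite h//; first by apply: eq_integral => y _; rewrite !funeposE.
  exact: measurable_funepos.
- rewrite h//; first by apply: eq_integral => y _; rewrite !funenegE.
  exact: measurable_funeneg.
Qed.

Local Notation edist := Defs.edist.

Section euclidean_distance.
Context {R : realType} (d : nat).
Local Notation V := (d.-tuple R).
Implicit Types x y z : V.

Definition sub_tuple x y : V := [tuple tnth x i - tnth y i | i < d].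

Lemma edist_enorm x y : edist x y = enorm (sub_tuple x y).
Proof. by []. Qed.

Lemma enorm_sqr x : enorm x ^+ 2 = \sum_(i < d) tnth x i ^+ 2.
Proof. by rewrite sqr_sqrtr// sumr_ge0// => i _; exact: sqr_ge0. Qed.

Lemma enorm_eq0 x : enorm x = 0 -> forall i, tnth x i = 0.
Proof.
move=> x0 i; apply/normr0_eq0/le_anti.
by rewrite normr_ge0 andbT -x0 normr_tnth_le_enorm.
Qed.

Lemma edist_eq0 x y : (edist x y == 0) = (x == y).
Proof.
apply/eqP/eqP => [/enorm_eq0 xy|->].
  by apply: eq_from_tnth => i; have := xy i; rewrite tnth_mktuple => /subr0_eq.
rewrite /edist /enorm big1 ?sqrtr0// => i _.
by rewrite tnth_mktuple subrr expr0n.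
Qed.

Lemma edist_sym x y : edist x y = edist y x.
Proof.
by rewrite /edist /enorm; congr Num.sqrt; apply: eq_bigr => i _;
  rewrite !tnth_mktuple -sqrrN opprB.
Qed.

Lemma enorm_sub_le x y : enorm (sub_tuple x y) <= enorm x + enorm y.
Proof.
have [x0|x0] := eqVneq (enorm x) 0.
  rewrite x0 add0r /enorm le_eqVlt; apply/orP; left; apply/eqP.
  congr Num.sqrt; apply: eq_bigr => i _.
  by rewrite tnth_mktuple (enorm_eq0 x0) sub0r sqrrN.
have [y0|y0] := eqVneq (enorm y) 0.
  rewrite y0 addr0 /enorm le_eqVlt; apply/orP; left; apply/eqP.
  congr Num.sqrt; apply: eq_bigr => i _.
  by rewrite tnth_mktuple (enorm_eq0 y0) subr0.
have {}x0 : 0 < enorm x by rewrite lt_def x0 enorm_ge0.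
have {}y0 : 0 < enorm y by rewrite lt_def y0 enorm_ge0.
set a := enorm x; set b := enorm y.
rewrite -(ler_pXn2r (_ : (0 < 2)%N)) ?nnegrE ?addr_ge0 ?enorm_ge0//.
rewrite enorm_sqr.
(* Young's inequality with weight |y| / |x|, the one that makes the sum equal
   to (|x| + |y|)^2. *)
apply: (@le_trans _ _ (\sum_(i < d) ((1 + b / a) * tnth x i ^+ 2 + (1 + a / b) * tnth y i ^+ 2))).
  apply: ler_sum => i _; rewrite tnth_mktuple.
  set s := tnth x i; set t := tnth y i.
  rewrite -subr_ge0.
  have -> : (1 + b / a) * s ^+ 2 + (1 + a / b) * t ^+ 2 - (s - t) ^+ 2 =
            (b * s + a * t) ^+ 2 / (a * b).
    by field; rewrite !gt_eqF.
  by rewrite divr_ge0 ?sqr_ge0// mulr_ge0// ltW.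
rewrite big_split/= -!mulr_sumr -!enorm_sqr -/a -/b.
rewrite le_eqVlt; apply/orP; left; apply/eqP; field.
by rewrite !gt_eqF.
Qed.

Lemma measurable_edist :
  measurable_fun setT (fun p : V * V => edist p.1 p.2).
Proof.
apply: (measurableT_comp (@measurable_enorm R d)).
apply/measurable_fun_tnthP => i.
rewrite (_ : _ \o _ = fun p : V * V => tnth p.1 i - tnth p.2 i); last first.
  by apply/funext => p /=; rewrite tnth_mktuple.
apply: measurable_funB.
- exact: (measurableT_comp (measurable_tnth i) measurable_fst).
- exact: (measurableT_comp (measurable_tnth i) measurable_snd).
Qed.

End euclidean_distance.

Section log_kernel_theory.
Context {R : realType} (d : nat).
Local Notation V := (d.-tuple R).
Implicit Types (T : R) (x y z : V).

Lemma edist_gt0 x y : x != y -> 0 < edist x y.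
Proof. by move=> xy; rewrite lt_def edist_eq0 xy; exact: enorm_ge0. Qed.

Lemma log_kernelE T x y : 0 < T ->
  log_kernel T x y = if x == y then +oo%E else (ln T - ln (edist x y))%:E.
Proof.
move=> T0; rewrite /log_kernel; case: ifPn => // xy.
by rewrite ln_div// posrE edist_gt0.
Qed.

Lemma measurable_log_kernel T : 0 < T ->
  measurable_fun setT (fun p : V * V => log_kernel T p.1 p.2).
Proof.
move=> T0; under eq_fun do rewrite log_kernelE//.
apply: measurable_fun_ifT => //.
- rewrite (_ : (fun _ => _) = fun p : V * V => edist p.1 p.2 == 0); last first.
    by apply/funext => p; rewrite edist_eq0.
  by apply: measurable_fun_eqr => //; exact: measurable_edist.
- apply/measurable_EFinP; apply: measurable_funB => //.
  by apply: measurableT_comp => //; exact: measurable_edist.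
Qed.

Lemma log_kernel_sym T x y : log_kernel T x y = log_kernel T y x.
Proof. by rewrite /log_kernel eq_sym edist_sym. Qed.

Lemma log_kernel_ge T x y : 0 < T -> enorm x < 1 -> enorm y < 1 ->
  ((- `|ln T - ln 2|)%:E <= log_kernel T x y)%E.
Proof.
move=> T0 x1 y1; rewrite log_kernelE//; case: ifPn => [_|xy]; first exact: leey.
have e2 : edist x y <= 2.
  by rewrite (le_trans (enorm_sub_le x y))//; lra.
have le2 : ln (edist x y) <= ln 2 by rewrite ler_ln ?posrE ?edist_gt0.
by rewrite lee_fin; have := ler_norm (- (ln T - ln 2)); rewrite normrN; lra.
Qed.

(** On the unit ball the kernel is bounded below, so it differs from its
    absolute value by a bounded amount. *)
Lemma abs_log_kernel_le T x y : 0 < T -> enorm x < 1 -> enorm y < 1 ->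
  (`|log_kernel T x y| <= log_kernel T x y + (2 * `|ln T - ln 2|)%:E)%E.
Proof.
move=> T0 x1 y1; have := log_kernel_ge T0 x1 y1.
case: (log_kernel T x y) => [k| |]; rewrite ?leye_eq ?leeNy_eq//.
have := normr_ge0 (ln T - ln 2).
by rewrite !lee_fin ler_norml => a0 h; apply/andP; split; lra.
Qed.

Lemma edist_scale (r : R) x y : 0 < r ->
  edist (scale_tuple r x) (scale_tuple r y) = r * edist x y.
Proof.
move=> r0; rewrite !edist_enorm -[in RHS](gtr0_norm r0) -enorm_scale.
congr enorm; apply: eq_from_tnth => i.
by rewrite !tnth_mktuple mulrBr.
Qed.

Lemma log_kernel_scale T (r : R) x y : 0 < T -> 0 < r ->
  log_kernel T (scale_tuple r x) (scale_tuple r y) =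
  (log_kernel T x y + (ln r^-1)%:E)%E.
Proof.
move=> T0 r0; rewrite !log_kernelE// -edist_eq0 edist_scale// mulf_eq0 gt_eqF//= edist_eq0.
case: ifPn => // xy; rewrite -EFinD lnM ?posrE ?edist_gt0// lnV ?posrE//.
by congr EFin; ring.
Qed.

Lemma scale_affine_map (r e : R) y u : r != 0 ->
  affine_map e (scale_tuple r y) u = scale_tuple r (affine_map (e / r) y u).
Proof.
move=> r0; apply: eq_from_tnth => i; rewrite !tnth_mktuple mulrBr.
by congr (_ - _); field.
Qed.

Lemma log_kernel_translate T (e : R) x y u v :
  log_kernel T (affine_map e x u) (affine_map e x v) =
  log_kernel T (affine_map e y u) (affine_map e y v).
Proof.
have ee : edist (affine_map e x u) (affine_map e x v) = edist (affine_map e y u) (affine_map e y v).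
  by rewrite !edist_enorm; congr enorm; apply: eq_from_tnth => i; rewrite !tnth_mktuple; ring.
by rewrite /log_kernel -!edist_eq0 ee.
Qed.

(** Brings the potential of a mollified point mass to the form that the
    integrability condition on the mollifier controls. *)
Lemma log_kernel_affine_map T (e : R) x y u : 0 < T -> 0 < e ->
  log_kernel T x (affine_map e y u) =
  (log_kernel 1 [tuple ((tnth y i - tnth x i) / e)%R | i < d] u + (ln T - ln e)%:E)%E.
Proof.
move=> T0 e0; set z := (X in log_kernel 1 X u).
have ez : edist x (affine_map e y u) = e * edist z u.
  rewrite !edist_enorm -[in RHS](gtr0_norm e0) -enorm_scale /enorm.
  congr Num.sqrt; apply: eq_bigr => i _; rewrite !tnth_mktuple -sqrrN.
  by congr (_ ^+ 2); field; rewrite gt_eqF.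
rewrite !log_kernelE// -!edist_eq0 ez mulf_eq0 gt_eqF//= edist_eq0.
case: ifPn => // zu; rewrite -EFinD lnM ?posrE ?edist_gt0// ln1.
by congr EFin; ring.
Qed.

End log_kernel_theory.

(** * Finiteness of mutual energies *)

Section finite_energy_pairs.
Context {R : realType} (d : nat) (dO : measure_display)
  (Omega : measurableType dO) (P : probability Omega R).
Local Notation V := (d.-tuple R).
Local Notation ball1 := (eball d (1 : R)).
Variables (T : R) (Z : signed_measure (R := R) d -> {RV P >-> R}).
Hypotheses (T0 : 0 < T) (hZ : log_gaussian_field T Z).

Definition nonneg_measure (m : {finite_measure set V -> \bar R}) : signed_measure d :=
  SignedMeasure m mzero.

Definition mutual_energy (m1 m2 : {finite_measure set V -> \bar R}) : \bar R :=
  (\int[m1]_x \int[m2]_y log_kernel T x y)%E.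

Lemma log_pairing_nonneg m1 m2 :
  log_pairing T (nonneg_measure m1) (nonneg_measure m2) = fine (mutual_energy m1 m2).
Proof.
rewrite /log_pairing /= !integral_measure_zero !subr0.
under [X in _ - fine X]eq_integral do rewrite integral_measure_zero.
by rewrite integral0 subr0 addr0.
Qed.

Lemma admissible_nonneg m : finite_energy T m -> admissible T (nonneg_measure m).
Proof.
move=> fm; split => //; split => //=.
by rewrite integral_measure_zero ltry.
Qed.

Local Notation k := (@log_kernel R d T).
Let mk := @measurable_log_kernel R d T T0.

Let mk1 x : measurable_fun setT (k x).
Proof. exact: measurableT_comp mk (measurable_pair1 x). Qed.

Let mak : measurable_fun setT (fun p : V * V => `|k p.1 p.2|)%E.
Proof. exact: measurableT_comp. Qed.

Let mak1 x : measurable_fun setT (fun y => `|k x y|)%E.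
Proof. exact: measurableT_comp. Qed.

Lemma measurable_abs_potential (m : {finite_measure set V -> \bar R}) :
  measurable_fun setT (fun x => \int[m]_y `|k x y|)%E.
Proof. exact: (@measurable_fun_integral_section _ _ _ _ _ m (fun x y => `|k x y|)%E). Qed.

Lemma measurable_potential (m : {finite_measure set V -> \bar R}) :
  measurable_fun setT (fun x => \int[m]_y k x y)%E.
Proof. exact: (@measurable_fun_integral_section _ _ _ _ _ m k). Qed.

Lemma abs_mutual_energy_le (m1 m2 : {finite_measure set V -> \bar R}) :
  (`|mutual_energy m1 m2| <= \int[m1]_x \int[m2]_y `|k x y|)%E.
Proof.
apply: le_trans (le_abse_integral _ _ _) _ => //; first exact: measurable_potential.
apply: ge0_le_integral => //.
- by apply: measurableT_comp => //; exact: measurable_potential.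
- exact: measurable_abs_potential.
- by move=> x _; apply: le_abse_integral.
Qed.

Lemma energy_mrestr_le (m : {finite_measure set V -> \bar R}) (D : set V) (mD : measurable D) :
  (\int[mrestr m mD]_x \int[mrestr m mD]_y `|k x y| <=
   \int[m]_x \int[m]_y `|k x y|)%E.
Proof.
rewrite ge0_integral_mrestr; last 2 first.
- exact: measurable_abs_potential.
- by move=> x; exact: integral_ge0.
apply: (@le_trans _ _ (\int[m]_(x in D) \int[m]_y `|k x y|)%E).
  apply: ge0_le_integral => //.
  - by move=> x _; exact: integral_ge0.
  - by apply: measurable_funTS; exact: measurable_abs_potential.
  - by apply: measurable_funTS; exact: measurable_abs_potential.
  - move=> x _; rewrite ge0_integral_mrestr//.
    by apply: ge0_subset_integral.
apply: ge0_subset_integral => //; first exact: measurable_abs_potential.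
by move=> x _; exact: integral_ge0.
Qed.

Lemma finite_energy_mrestr m (D : set V) (mD : measurable D) :
  finite_energy T m -> finite_energy T (mrestr m mD).
Proof.
move=> [m0 mE]; split.
  apply/eqP; rewrite eq_le measure_ge0 andbT -m0 /= /mrestr.
  have mb := measurableC (measurable_eball d (1 : R)).
  by apply: le_measure; rewrite ?inE//; exact: measurableI.
exact: le_lt_trans (energy_mrestr_le m mD) mE.
Qed.

(** The variance of [Z(m1) - Z(m2)] is nonnegative. *)
Lemma log_pairing_pos_def (m1 m2 : {finite_measure set V -> \bar R}) :
  finite_energy T m1 -> finite_energy T m2 ->
  fine (mutual_energy m1 m2) + fine (mutual_energy m2 m1) <=
  fine (mutual_energy m1 m1) + fine (mutual_energy m2 m2).
Proof.
move=> f1 f2.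
pose c (i : 'I_2) : R := if i == ord0 then 1 else - 1.
pose mu (i : 'I_2) := nonneg_measure (if i == ord0 then m1 else m2).
have amu i : admissible T (mu i).
  by rewrite /mu; case: ifP => _; exact: admissible_nonneg.
have := centered_gaussian_var_ge0 (hZ c amu).
rewrite !big_ord_recl !big_ord0 /c /mu /= !log_pairing_nonneg.
lra.
Qed.

Lemma mutual_energy_sym (m1 m2 : {finite_measure set V -> \bar R}) :
  (\int[m1]_x \int[m2]_y `|k x y| < +oo)%E ->
  mutual_energy m1 m2 = mutual_energy m2 m1.
Proof.
move=> fin; rewrite /mutual_energy.
have /(@Fubini _ _ _ _ _ m1 m2 (fun p => k p.1 p.2)) /= : 
    (m1 \x m2)%E.-integrable setT (fun p : V * V => k p.1 p.2).
  exact/(@integrable12ltyP _ _ _ _ _ m1 m2 _ mk).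
move=> ->; apply: eq_integral => y _; apply: eq_integral => x _.
exact: log_kernel_sym.
Qed.

Lemma le_fine_abs (z E : \bar R) : (`|z| <= E)%E -> (E < +oo)%E -> `|fine z| <= fine E.
Proof.
by case: z E => [z| |] [E| |]//=; rewrite ?lee_fin// normr0.
Qed.

(** Positive definiteness gives [2 <m, m2> <= <m, m> + <m2, m2>], but only when
    [<m, m2>] is already known to converge. It is therefore applied to the
    restriction of [m1] to the set [A n] where the potential of [m2] is at most
    [n]; the bound does not depend on [n], and the sets [A n] exhaust the ball
    since the potential is finite everywhere. *)
Lemma mutual_energy_lty (m1 m2 : {finite_measure set V -> \bar R}) :
  finite_energy T m1 -> finite_energy T m2 ->
  (forall x, \int[m2]_y `|k x y| < +oo)%E ->
  (\int[m1]_x \int[m2]_y `|k x y| < +oo)%E.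
Proof.
move=> f1 f2 Ufin; pose U x := (\int[m2]_y `|k x y|)%E.
have mU : measurable_fun setT U := measurable_abs_potential m2.
have U0 x : (0 <= U x)%E by exact: integral_ge0.
pose A n := ball1 `&` [set x | (U x <= n%:R%:E)%E].
have mA n : measurable (A n).
  apply: measurableI; first exact: measurable_eball.
  by rewrite -[X in measurable X]setTI; apply: emeasurable_fun_infty_c.
have AE : \bigcup_n A n = ball1.
  apply/seteqP; split => [x [n _ []]//|x bx].
  exists (Num.truncn (fine (U x))).+1 => //; split => //=.
  have Ux : U x \is a fin_num by rewrite ge0_fin_numE//; exact: Ufin.
  by rewrite -(fineK Ux) lee_fin ltW// truncnS_gt.
have ndA : nondecreasing_seq A.
  move=> i j ij; apply/subsetPset => x [bx /= Ux]; split => //=.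
  by rewrite (le_trans Ux)// lee_fin ler_nat.
(* The cost of replacing the kernel by its absolute value, which is bounded below
   on the ball by [- |ln T - ln 2|]. *)
pose kap := 2 * `|ln T - ln 2|.
have kap0 : 0 <= kap by rewrite mulr_ge0.
pose C : \bar R := ((fine (\int[m1]_x \int[m1]_y `|k x y|) +
    fine (\int[m2]_x \int[m2]_y `|k x y|))%:E + kap%:E * m2 setT * m1 setT)%E.
have UC n : (\int[m1]_(x in A n) U x <= C)%E.
  pose mn := mrestr m1 (mA n).
  have fn : finite_energy T mn by exact: finite_energy_mrestr.
  have Ulty : (\int[m1]_(x in A n) U x < +oo)%E.
    apply: (@le_lt_trans _ _ (\int[m1]_(x in A n) cst n%:R%:E x)%E).
      apply: ge0_le_integral => //; first exact: measurable_funTS.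
      by move=> x [].
    by rewrite integral_cst// lte_mul_pinfty//; rewrite ?lee_fin//;
      rewrite ltey_eq fin_num_measure.
  have mnfin : (\int[mn]_x \int[m2]_y `|k x y| < +oo)%E.
    by rewrite ge0_integral_mrestr.
  have Ebnd (m m' : {finite_measure set V -> \bar R}) :
      (\int[m]_x \int[m']_y `|k x y| < +oo)%E ->
      `|fine (mutual_energy m m')| <= fine (\int[m]_x \int[m']_y `|k x y|)%E.
    exact: le_fine_abs (abs_mutual_energy_le m m').
  have p01 : 2 * fine (mutual_energy mn m2) <=
      fine (\int[m1]_x \int[m1]_y `|k x y|)%E + fine (\int[m2]_x \int[m2]_y `|k x y|)%E.
    have := log_pairing_pos_def fn f2; rewrite -(mutual_energy_sym mnfin).
    rewrite mulr_natl mulr2n => /le_trans; apply; apply: lerD; last first.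
      by apply: le_trans (ler_norm _) _; apply: Ebnd; case: f2.
    apply: le_trans (ler_norm _) _; apply: (@le_trans _ _ (fine (\int[mn]_x \int[mn]_y `|k x y|)%E)).
      by apply: Ebnd; case: fn.
    apply: fine_le; last exact: energy_mrestr_le.
      by rewrite ge0_fin_numE; [case: fn|apply: integral_ge0 => *; exact: integral_ge0].
    by rewrite ge0_fin_numE; [case: f1|apply: integral_ge0 => *; exact: integral_ge0].
  pose W x := (\int[m2]_y k x y)%E.
  have m2ae (Q : V -> Prop) : (forall y, ball1 y -> Q y) -> {ae m2, forall y, Q y}.
    move=> BQ; exists (~` ball1); split.
    - by apply: measurableC; exact: measurable_eball.
    - by case: f2.
    - by move=> y; apply: contra_not; exact: BQ.
  have ik x : m2.-integrable setT (k x) by apply/integrableP; split => //; exact: Ufin.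
  have ikap : m2.-integrable setT (cst kap%:E) by exact: (finite_measure_integrable_cst m2 kap).
  have UW x : ball1 x -> (U x <= W x + kap%:E * m2 setT)%E.
    move=> bx; have kx y : ball1 y -> (`|k x y| <= k x y + kap%:E)%E.
      exact: abs_log_kernel_le.
    have mkk : measurable_fun setT (fun y => k x y + kap%:E)%E.
      by apply: emeasurable_funD.
    have -> : (W x + kap%:E * m2 setT = \int[m2]_y (k x y + kap%:E))%E.
      by rewrite (integralD measurableT (ik x) ikap) integral_cst.
    have -> : (\int[m2]_y (k x y + kap%:E) = \int[m2]_y `|k x y + kap%:E|)%E.
      apply: ae_eq_integral => //; first exact: measurableT_comp.
      apply: m2ae => y By _; rewrite gee0_abs//.
      exact: le_trans (abse_ge0 _) (kx y By).
    apply: ae_ge0_le_integral => //; first exact: measurableT_comp.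
    apply: m2ae => y By _; apply: le_trans (kx y By) _.
    by rewrite gee0_abs//; exact: le_trans (abse_ge0 _) (kx y By).
  have iU : m1.-integrable (A n) U.
    apply/integrableP; split; first exact: measurable_funTS.
    by under eq_integral do rewrite gee0_abs//.
  have mW : measurable_fun setT W := measurable_potential m2.
  have iW : m1.-integrable (A n) W.
    apply: le_integrable iU => //; first exact: measurable_funTS.
    move=> x _; rewrite (gee0_abs (U0 x)); exact: le_abse_integral.
  have m2fin : m2 setT \is a fin_num by exact: fin_num_measure.
  have icst : m1.-integrable (A n) (cst (kap%:E * m2 setT)%E).
    rewrite -(fineK m2fin) -EFinM.
    exact: (finite_measure_integrable_cst m1 (kap * fine (m2 setT)) (mA n)).
  apply: (@le_trans _ _ (\int[m1]_(x in A n) (W x + kap%:E * m2 setT))%E).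
    apply: le_integral => //; first exact: integrableD.
    by move=> x; rewrite inE => -[bx _]; exact: UW.
  rewrite integralD// integral_cst// -(integral_mrestr m1 (mA n) mW).
  rewrite -/mn -/(mutual_energy mn m2).
  have efin : mutual_energy mn m2 \is a fin_num.
    by rewrite fin_num_abs (le_lt_trans (abs_mutual_energy_le mn m2)).
  apply: leeD.
    have E0 (m : {finite_measure set V -> \bar R}) : 0 <= fine (\int[m]_x \int[m]_y `|k x y|)%E.
      by apply: fine_ge0; apply: integral_ge0 => x _; exact: integral_ge0.
    have half_le (p S : R) : 2 * p <= S -> 0 <= S -> p <= S by lra.
    rewrite -(fineK efin) lee_fin.
    exact: half_le p01 (addr_ge0 (E0 m1) (E0 m2)).
  apply: lee_pmul => //; first by rewrite mule_ge0 ?lee_fin.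
  by apply: le_measure; rewrite ?inE.
have Ccvg := @ge0_nondecreasing_set_cvg_integral _ _ _ A U m1 ndA mA
  (fun n => measurable_funTS mU) (fun n x _ => U0 x).
rewrite AE in Ccvg.
have -> : (\int[m1]_x U x = \int[m1]_(x in ball1) U x)%E.
  rewrite (@ge0_negligible_integral _ _ _ m1 setT (~` ball1))//.
  - by rewrite setTD setCK.
  - by apply: measurableC; exact: measurable_eball.
  - by case: f1.
rewrite -(cvg_lim _ Ccvg)//; apply: (@le_lt_trans _ _ C).
  by apply: lime_le; [apply/cvg_ex; eexists; exact: Ccvg|exact: nearW].
by rewrite ltey_eq /C fin_numD /= fin_numM ?fin_numM ?fin_num_measure.
Qed.

End finite_energy_pairs.

(** * Energies of mollified point masses *)

Section mollified_dirac_theory.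
Context {R : realType} (d : nat).
Local Notation V := (d.-tuple R).
Variables (theta : probability V R) (htheta : mollifier theta).
Variables (T : R) (T0 : 0 < T).
Local Notation k := (@log_kernel R d T).

(** As long as [x + e B] stays inside the unit ball, the restriction to it
    removes no mass. *)
Lemma mollified_diracE (e : R) (x : V) (A : set V) : 0 < e -> enorm x + e < 1 ->
  measurable A ->
  mollified_dirac theta e x A = theta (affine_map e x @^-1` A).
Proof.
move=> e0 xe mA.
have -> : mollified_dirac theta e x A =
  theta (affine_map e x @^-1` (A `&` eball d (1 : R))) by [].
rewrite preimage_setI.
have mB (B : set V) : measurable B -> measurable (affine_map e x @^-1` B).
  by move=> mB; rewrite -[X in measurable X]setTI; exact: measurable_affine_map.
have mb := mB _ (measurable_eball d (1 : R)).
rewrite [RHS](measureDI theta (mB _ mA) mb) [X in (X + _)%E](_ : _ = 0%E) ?add0e//.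
apply/eqP; rewrite eq_le measure_ge0 andbT; case: htheta => <- _.
apply: le_measure; rewrite ?inE.
- by apply: measurableD => //; exact: mB.
- rewrite (_ : mkset _ = @enorm R d @^-1` `]1, +oo[).
    by rewrite -[X in measurable X]setTI; exact: measurable_enorm.
  by apply/seteqP; split=> u; rewrite /= in_itv/= andbT.
- move=> u [_ /= nb]; rewrite ltNge; apply/negP => u1; apply: nb; rewrite /eball/=.
  have -> : affine_map e x u = sub_tuple x (scale_tuple e u).
    by apply: eq_from_tnth => i; rewrite !tnth_mktuple.
  rewrite (le_lt_trans (enorm_sub_le _ _))// enorm_scale gtr0_norm//.
  by apply: le_lt_trans xe; rewrite lerD2l ler_piMr// ltW.
Qed.

Lemma integral_mollified_dirac (e : R) (x : V) (f : V -> \bar R) :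
  0 < e -> enorm x + e < 1 -> measurable_fun setT f ->
  (\int[mollified_dirac theta e x]_y f y = \int[theta]_u f (affine_map e x u))%E.
Proof.
move=> e0 xe mf; apply: (integral_image_measure (measurable_affine_map e x)) => // A mA.
exact: mollified_diracE.
Qed.

Lemma mollified_potential_lty (e : R) (x z : V) : 0 < e -> enorm x + e < 1 ->
  (\int[mollified_dirac theta e x]_y `|k z y| < +oo)%E.
Proof.
move=> e0 xe.
have mk1 (S : R) (v : V) : 0 < S -> measurable_fun setT (@log_kernel R d S v).
  by move=> S0; exact: measurableT_comp (measurable_log_kernel S0) (measurable_pair1 v).
rewrite integral_mollified_dirac//; last by apply: measurableT_comp => //; exact: mk1.
under eq_integral do rewrite (log_kernel_affine_map z x _ T0 e0).
set v : V := [tuple (tnth x i - tnth z i) / e | i < d]; case: htheta => _ /(_ v) vfin.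
apply: (@le_lt_trans _ _ (\int[theta]_u (`|log_kernel 1 v u| + `|ln T - ln e|%:E))%E).
  apply: ge0_le_integral => //.
  - by apply: measurableT_comp => //; apply: emeasurable_funD => //; exact: mk1.
  - by apply: emeasurable_funD => //; apply: measurableT_comp => //; exact: mk1.
  - by move=> u _; exact: lee_abs_add.
rewrite ge0_integralD//; last by apply: measurableT_comp => //; exact: mk1.
by rewrite integral_probability_cst lte_add_pinfty// ltry.
Qed.

Lemma mutual_energy_mollified (e : R) (x x' : V) : 0 < e ->
  enorm x + e < 1 -> enorm x' + e < 1 ->
  mutual_energy T (mollified_dirac theta e x) (mollified_dirac theta e x') =
  (\int[theta]_u \int[theta]_v k (affine_map e x u) (affine_map e x' v))%E.
Proof.
move=> e0 xe xe'.
pose m' := mollified_dirac theta e x'.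
have mp : measurable_fun setT (fun y => \int[m']_y' k y y')%E.
  exact: (measurable_potential T0 m').
rewrite [LHS](integral_mollified_dirac e0 xe mp).
apply: eq_integral => u _; apply: integral_mollified_dirac => //.
exact: measurableT_comp (measurable_log_kernel T0) (measurable_pair1 _).
Qed.

Lemma mutual_energy_translate (e : R) (x y : V) : 0 < e ->
  enorm x + e < 1 -> enorm y + e < 1 ->
  mutual_energy T (mollified_dirac theta e x) (mollified_dirac theta e x) =
  mutual_energy T (mollified_dirac theta e y) (mollified_dirac theta e y).
Proof.
move=> e0 xe ye; rewrite (mutual_energy_mollified e0 xe xe) (mutual_energy_mollified e0 ye ye).
by apply: eq_integral => u _; apply: eq_integral => v _; exact: log_kernel_translate.
Qed.

(** The affine map with scale [e] based at [r y] is [r] times the one with scale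
    [e / r] based at [y]; the kernel then gains the constant [ln(1/r)], which is
    integrated against two measures of mass 1. *)
Lemma mutual_energy_scale (r e : R) (y y' : V) : 0 < r -> r < 1 -> 0 < e ->
  enorm y + e / r < 1 -> enorm y' + e / r < 1 ->
  (\int[mollified_dirac theta (e / r) y]_x
    \int[mollified_dirac theta (e / r) y']_x' `|k x x'| < +oo)%E ->
  fine (mutual_energy T (mollified_dirac theta e (scale_tuple r y))
    (mollified_dirac theta e (scale_tuple r y'))) =
  fine (mutual_energy T (mollified_dirac theta (e / r) y)
    (mollified_dirac theta (e / r) y')) + ln r^-1.
Proof.
move=> r0 r1 e0 ye ye' fin.
have er0 : 0 < e / r by rewrite divr_gt0.
have ire (z : V) : enorm z + e / r < 1 -> enorm (scale_tuple r z) + e < 1.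
  move=> ze; rewrite enorm_scale gtr0_norm// -[e](divfK (lt0r_neq0 r0)) mulrC -mulrDl.
  have h : 0 <= enorm z + e / r by rewrite addr_ge0 ?enorm_ge0// ltW.
  by rewrite mulrC (le_lt_trans _ ze)// ler_piMl// ltW.
set m1 := mollified_dirac theta (e / r) y in fin *.
set m2 := mollified_dirac theta (e / r) y' in fin *.
have mk1 (v : V) : measurable_fun setT (k v).
  exact: measurableT_comp (measurable_log_kernel T0) (measurable_pair1 v).
have ik v : m2.-integrable setT (k v).
  by apply/integrableP; split=> //; exact: mollified_potential_lty.
have m2T : m2 setT = 1%E.
  by rewrite mollified_diracE// preimage_setT probability_setT.
have m1T : m1 setT = 1%E.
  by rewrite mollified_diracE// preimage_setT probability_setT.
have mV : measurable_fun setT (fun x => \int[m2]_y k x y)%E.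
  exact: (measurable_potential T0 m2).
have iV : m1.-integrable setT (fun x => \int[m2]_y k x y)%E.
  apply/integrableP; split=> //; apply: le_lt_trans fin.
  apply: ge0_le_integral => //.
  - exact: measurableT_comp.
  - exact: (measurable_abs_potential T0 m2).
  - by move=> x _; exact: le_abse_integral.
have -> : mutual_energy T (mollified_dirac theta e (scale_tuple r y))
    (mollified_dirac theta e (scale_tuple r y')) = (mutual_energy T m1 m2 + (ln r^-1)%:E)%E.
  rewrite (mutual_energy_mollified e0 (ire _ ye) (ire _ ye')).
  under eq_integral do under eq_integral do rewrite !scale_affine_map ?gt_eqF// log_kernel_scale//.
  transitivity (\int[m1]_x \int[m2]_x' (k x x' + (ln r^-1)%:E))%E.
    have mp : measurable_fun setT (fun x => \int[m2]_x' (k x x' + (ln r^-1)%:E))%E.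
      apply: (@measurable_fun_integral_section _ _ _ _ _ m2 (fun x x' => k x x' + (ln r^-1)%:E)%E).
      by apply: emeasurable_funD => //; exact: measurable_log_kernel.
    rewrite [RHS](integral_mollified_dirac er0 ye mp).
    apply: eq_integral => u _; apply/esym/integral_mollified_dirac => //.
    exact: emeasurable_funD.
  have ic (m : {finite_measure set V -> \bar R}) : m.-integrable setT (cst (ln r^-1)%:E).
    exact: (finite_measure_integrable_cst m (ln r^-1)).
  have intc (m : {finite_measure set V -> \bar R}) : m setT = 1%E ->
      (\int[m]__ (ln r^-1)%:E = (ln r^-1)%:E)%E.
    by move=> mT; rewrite integral_cst// [X in (_ * X)%E](_ : _ = 1%E)// mule1.
  under eq_integral do rewrite (integralD measurableT (ik _) (ic m2)) (intc _ m2T).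
  by rewrite (integralD measurableT iV (ic m1)) (intc _ m1T).
rewrite fineD// fin_num_abs; apply: le_lt_trans fin.
exact: abs_mutual_energy_le.
Qed.

End mollified_dirac_theory.

(** * The mollified field *)

Section scaled_field.
Context {R : realType} (d : nat) (dO : measure_display)
  (Omega : measurableType dO) (P : probability Omega R).
Local Notation V := (d.-tuple R).
Local Notation RM := (measurableTypeR R).
Local Notation ball1 := (eball d (1 : R)).
Local Notation N01 := (@normal_prob R 0 1).
Variables (T : R) (Z : signed_measure (R := R) d -> {RV P >-> R}).
Hypotheses (T0 : 0 < T) (hZ : log_gaussian_field T Z).
Variables (theta : probability V R) (htheta : mollifier theta).
Variables (Zeps : R -> V -> Omega -> R) (hZeps : convolution_of T Z theta Zeps).

Definition field_cov (e : R) (x y : V) : R :=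
  fine (mutual_energy T (mollified_dirac theta e x) (mollified_dirac theta e y)).

(** The field set to 0 outside the unit ball, which makes it measurable on the
    whole product space. *)
Definition ball_field (e : R) (x : V) (w : Omega) : R :=
  ((fun z : V * Omega => Zeps e z.1 z.2) \_ (ball1 `*` [set: Omega])) (x, w).

Lemma ball_fieldE e x w : enorm x < 1 -> ball_field e x w = Zeps e x w.
Proof. by move=> x1; rewrite /ball_field patchE mem_set. Qed.

Lemma measurable_ball_field e : 0 < e ->
  measurable_fun setT (fun z : V * Omega => ball_field e z.1 z.2).
Proof.
move=> e0; have [_ mZ] := hZeps e0.
have mB : measurable (ball1 `*` [set: Omega]).
  by apply: measurableX => //; exact: measurable_eball.
rewrite (_ : (fun z => _) = (fun z : V * Omega => Zeps e z.1 z.2) \_ (ball1 `*` setT)).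
  exact/(measurable_restrictT _ mB).
by apply/funext => -[].
Qed.

Lemma finite_energy_mollified e x : 0 < e -> enorm x < 1 ->
  finite_energy T (mollified_dirac theta e x).
Proof. by move=> e0 x1; have [/(_ x x1)[[]]] := hZeps e0. Qed.

Lemma mutual_energy_mollified_lty e x y : 0 < e -> enorm x < 1 -> enorm y + e < 1 ->
  (\int[mollified_dirac theta e x]_x'
    \int[mollified_dirac theta e y]_y' `|log_kernel T x' y'| < +oo)%E.
Proof.
move=> e0 x1 ye; apply: (mutual_energy_lty T0 hZ).
- exact: finite_energy_mollified.
- by apply: finite_energy_mollified => //; apply: le_lt_trans ye; rewrite lerDl ltW.
- by move=> z; exact: mollified_potential_lty.
Qed.

Definition form_var e (s : seq (R * V)) : R :=
  \sum_(p <- s) \sum_(q <- s) p.1 * q.1 * field_cov e p.2 q.2.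

(** Finite linear combinations of the mollified field agree almost surely with
    those of [Z] at the mollified point masses, hence are centered normal with
    the variance of the quadratic form. *)
Lemma field_form_law e (s : seq (R * V)) (h : RM -> \bar R) : 0 < e ->
  (forall p, p \in s -> enorm p.2 < 1) ->
  measurable_fun setT h -> (forall x, 0 <= h x)%E ->
  0 <= form_var e s /\
  (\int[P]_w h (linear_form (ball_field e) s w) =
   \int[N01]_z h (Num.sqrt (form_var e s) * z)%R)%E.
Proof.
move=> e0 s1 mh h0.
pose c (i : 'I_(size s)) := (tnth (in_tuple s) i).1.
pose x (i : 'I_(size s)) := (tnth (in_tuple s) i).2.
have x1 i : enorm (x i) < 1 by apply: s1; exact: mem_tnth.
pose mu i := mollified_index theta e (x i).
have amu i : admissible T (mu i) by have [/(_ _ (x1 i))[]] := hZeps e0.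
have gZ := hZ c amu.
have vE : \sum_(i < size s) \sum_(j < size s) c i * c j * log_pairing T (mu i) (mu j) =
    form_var e s.
  rewrite /form_var [RHS]big_tnth; apply: eq_bigr => i _; rewrite [RHS]big_tnth.
  by apply: eq_bigr => j _; rewrite [log_pairing _ _ _]log_pairing_nonneg.
rewrite vE in gZ; split; first exact: centered_gaussian_var_ge0 gZ.
have mZ : measurable_fun setT (fun w => \sum_(i < size s) c i * Z (mu i) w).
  by apply: measurable_sum => i; exact: measurable_funM.
rewrite -(centered_gaussian_integral mZ gZ mh h0).
have mF : measurable_fun setT (linear_form (ball_field e) s).
  by apply: measurable_linear_form => y; exact: (measurable_process (measurable_ball_field e0)).
apply: ge0_ae_eq_integral => //.
- exact: measurableT_comp mh mF.
- exact: measurableT_comp mh mZ.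
have : {ae P, forall w, forall i, Zeps e (x i) w = Z (mu i) w}.
  have aeE i : {ae P, forall w, Zeps e (x i) w = Z (mu i) w}.
    by have [/(_ _ (x1 i))[]] := hZeps e0.
  exact: filter_forall aeE.
apply: filterS => w Ew _; congr h.
rewrite /linear_form [LHS]big_tnth; apply: eq_bigr => i _.
by rewrite (ball_fieldE e w (x1 i)) Ew.
Qed.

Lemma field_point_law e x (h : RM -> \bar R) : 0 < e -> enorm x < 1 ->
  measurable_fun setT h -> (forall x, 0 <= h x)%E ->
  0 <= field_cov e x x /\
  (\int[P]_w h (ball_field e x w) =
   \int[N01]_z h (Num.sqrt (field_cov e x x) * z)%R)%E.
Proof.
move=> e0 x1 mh h0.
have [|v0 hE] := @field_form_law e [:: (1, x)] h e0 _ mh h0.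
  by move=> p; rewrite inE => /eqP ->.
have vE : form_var e [:: (1, x)] = field_cov e x x.
  by rewrite /form_var !big_seq1 !mul1r.
rewrite vE in v0 hE; split => //; rewrite -hE; apply: eq_integral => w _.
by rewrite /linear_form big_seq1 mul1r.
Qed.

(** Kept symbolic instead of evaluated to 1: it only enters the scaling
    constant. *)
Definition normal_second_moment : R := fine (\int[N01]_z (z ^+ 2)%:E)%E.

Lemma normal_second_momentE :
  (normal_second_moment%:E = \int[N01]_z (z ^+ 2)%:E)%E.
Proof.
rewrite /normal_second_moment fineK// ge0_fin_numE; last first.
  by apply: integral_ge0 => z _; rewrite lee_fin sqr_ge0.
have mE : measurable_fun setT (fun z : RM => (expR (1 * `|z|))%:E).
  apply/measurable_EFinP; apply: measurableT_comp => //; exact: measurable_funM.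
apply: (@le_lt_trans _ _ (\int[N01]_z (2%:E * (expR (1 * `|z|))%:E))%E).
  apply: ge0_le_integral => //.
  - by move=> z _; rewrite lee_fin sqr_ge0.
  - by apply/measurable_EFinP; exact: measurable_funX.
  - exact: emeasurable_funM.
  - move=> z _; rewrite -EFinM lee_fin mul1r -[z ^+ 2](real_normK (num_real z)).
    have := expR_ge1Dxn 1 (normr_ge0 z); rewrite (_ : 2`! = 2%N)//.
    by lra.
rewrite ge0_integralZl//.
by rewrite lte_mul_pinfty// ?lee_fin//; exact: expR_normal_moment.
Qed.

Lemma field_variance e x : 0 < e -> enorm x < 1 ->
  fine 'E_P[(fun w => Zeps e x w ^+ 2)] = field_cov e x x * normal_second_moment.
Proof.
move=> e0 x1; rewrite unlock.
have mh : measurable_fun setT (fun z : RM => (z ^+ 2)%:E).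
  by apply/measurable_EFinP; exact: measurable_funX.
have [|v0 vE] := field_point_law e0 x1 mh; first by move=> z; rewrite lee_fin sqr_ge0.
transitivity (fine (\int[P]_w (ball_field e x w ^+ 2)%:E)%E).
  by congr fine; apply: eq_integral => w _; rewrite ball_fieldE.
rewrite vE; transitivity (fine ((field_cov e x x)%:E * \int[N01]_z (z ^+ 2)%:E)%E).
  rewrite -ge0_integralZl//.
    by congr fine; apply: eq_integral => z _; rewrite exprMn sqr_sqrtr.
  by move=> z _; rewrite lee_fin sqr_ge0.
by rewrite -normal_second_momentE.
Qed.

Lemma field_cov_diag e x y : 0 < e -> enorm x + e < 1 -> enorm y + e < 1 ->
  field_cov e x x = field_cov e y y.
Proof.
by move=> e0 xe ye; rewrite /field_cov (mutual_energy_translate htheta T0 e0 xe ye).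
Qed.

Lemma field_cov_scale r e y y' : 0 < r -> r < 1 -> 0 < e ->
  enorm y + e / r < 1 -> enorm y' + e / r < 1 ->
  field_cov e (scale_tuple r y) (scale_tuple r y') =
  field_cov (e / r) y y' + ln r^-1.
Proof.
move=> r0 r1 e0 ye ye'; have er0 : 0 < e / r by rewrite divr_gt0.
apply: (mutual_energy_scale htheta T0 r0 r1 e0 ye ye').
apply: mutual_energy_mollified_lty => //.
by apply: le_lt_trans ye; rewrite lerDl ltW.
Qed.

Definition origin : V := nseq_tuple d 0.

Lemma enorm_origin : enorm origin = 0.
Proof.
rewrite /enorm big1 ?sqrtr0// => i _.
by rewrite (tnth_nth 0)/= nth_nseq if_same expr0n.
Qed.

Lemma measurable_expR_ball_field (g e : R) : 0 < e ->
  measurable_fun setT (fun p : V * Omega => (expR (g * ball_field e p.1 p.2))%:E).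
Proof.
move=> e0; apply/measurable_EFinP; apply: measurableT_comp => //.
by apply: measurable_funM => //; exact: measurable_ball_field.
Qed.

(** The factor [exp(- g^2 / 2 * E Z_e(x)^2)], which is the same at all points
    [x] with [|x| + e < 1] by translation invariance of the kernel. *)
Definition gmc_normalization (g e : R) : R :=
  expR (- (g ^+ 2 / 2 * (field_cov e origin origin * normal_second_moment))).

Lemma gmc_approx_eball (g e rho : R) w : 0 < e -> rho + e < 1 ->
  gmc_approx P g Zeps e (eball d rho) w =
  ((gmc_normalization g e)%:E *
   \int[@lebesgue_tuple R d]_(x in eball d rho) (expR (g * ball_field e x w))%:E)%E.
Proof.
move=> e0 re; have mB := measurable_eball d rho.
rewrite /gmc_approx -ge0_integralZl//; last 2 first.
- apply: measurable_funTS.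
  exact: measurableT_comp (measurable_expR_ball_field g e0) (measurable_pair2 w).
- by rewrite lee_fin expR_ge0.
apply: eq_integral => x; rewrite inE /eball/= => xr.
have xe : enorm x + e < 1 by apply: lt_trans re; rewrite ltrD2r.
have x1 : enorm x < 1 by apply: lt_trans xe; rewrite ltrDl.
have oe : enorm origin + e < 1.
  by rewrite enorm_origin; apply: le_lt_trans xe; rewrite lerD2r enorm_ge0.
rewrite field_variance// (field_cov_diag e0 xe oe) ball_fieldE// -EFinM -expRD.
by congr (expR _)%:E; rewrite addrC.
Qed.

Lemma measurable_gmc_approx (g e rho : R) : 0 < e -> rho + e < 1 ->
  measurable_fun setT (fun w => gmc_approx P g Zeps e (eball d rho) w).
Proof.
move=> e0 re; under eq_fun do rewrite gmc_approx_eball//.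
apply: emeasurable_funM => //; under eq_fun do rewrite integral_mkcond.
apply: (@measurable_fun_fubini_tonelli_G _ _ _ _ _ (@lebesgue_tuple R d) (fun p : V * Omega =>
  ((fun x => (expR (g * ball_field e x p.2))%:E) \_ (eball d rho)) p.1)) => [|p].
  rewrite (_ : (fun _ => _) = fun p : V * Omega =>
    if enorm p.1 < rho then (expR (g * ball_field e p.1 p.2))%:E else 0%E).
    apply: measurable_fun_ifT => //; last exact: measurable_expR_ball_field.
    apply: measurable_fun_ltr => //.
    exact: measurableT_comp (@measurable_enorm R d) measurable_fst.
  apply/funext => p; rewrite patchE; case: ifPn => pr.
    by move: pr; rewrite inE /eball/= => ->.
  by case: ifP => // pr'; move: pr; rewrite mem_set.
by rewrite patchE; case: ifP => // _; rewrite lee_fin expR_ge0.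
Qed.

End scaled_field.

(** * Exact scaling at positive mollification *)

Section gmc_scaling.
Context {R : realType} (d : nat) (dO : measure_display)
  (Omega : measurableType dO) (P : probability Omega R).
Local Notation V := (d.-tuple R).
Local Notation RM := (measurableTypeR R).
Local Notation N01 := (@normal_prob R 0 1).
Local Notation leb := (@lebesgue_tuple R d).
Variables (T : R) (Z : signed_measure (R := R) d -> {RV P >-> R}).
Hypotheses (T0 : 0 < T) (hZ : log_gaussian_field T Z).
Variables (theta : probability V R) (htheta : mollifier theta).
Variables (Zeps : R -> V -> Omega -> R) (hZeps : convolution_of T Z theta Zeps).
Variables (r rho e g : R).
Hypotheses (r0 : 0 < r) (r1 : r < 1) (e0 : 0 < e)
  (rhoe : rho + e / r < 1) (g0 : 0 < g).

Local Notation bf := (ball_field Zeps).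
Local Notation cov := (field_cov T theta).
Local Notation B := (eball d rho).
Local Notation sigma := (Num.sqrt (ln r^-1)).

Let er0 : 0 < e / r. Proof. by rewrite divr_gt0. Qed.

Let rho1 : rho < 1. Proof. by apply: le_lt_trans rhoe; rewrite lerDl ltW. Qed.

Let lnr0 : 0 <= ln r^-1.
Proof. by rewrite ln_ge0// invf_ge1// ltW. Qed.

Let Bpoint (y : V) : enorm y < rho -> [/\ enorm y < 1, enorm y + e / r < 1,
  enorm (scale_tuple r y) < 1 & enorm (scale_tuple r y) + e < 1].
Proof.
move=> yr.
have y1 : enorm y < 1 := lt_trans yr rho1.
have ye : enorm y + e / r < 1 by apply: lt_trans rhoe; rewrite ltrD2r.
have sy : enorm (scale_tuple r y) + e < 1.
  rewrite enorm_scale gtr0_norm// -[e](divfK (lt0r_neq0 r0)) [_ / r * r]mulrC -mulrDr.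
  by apply: le_lt_trans ye; rewrite ler_piMl ?addr_ge0 ?enorm_ge0 ?ltW.
by split => //; apply: lt_trans sy; rewrite ltrDl.
Qed.

(** The two fields whose laws coincide; both are set to 0 outside [B], so that
    statements about all points of the space hold without side conditions. *)
Definition rescaled_field (y : V) (w : Omega) : R :=
  if enorm y < rho then bf e (scale_tuple r y) w else 0.

Definition shifted_field (y : V) (wn : Omega * RM) : R :=
  if enorm y < rho then bf (e / r) y wn.1 + sigma * wn.2 else 0.

Let measurable_ltB dT (S : measurableType dT) :
  measurable_fun setT (fun p : V * S => enorm (p.1 : V) < rho).
Proof.
apply: measurable_fun_ltr => //.
exact: measurableT_comp (@measurable_enorm R d) measurable_fst.
Qed.

Lemma measurable_rescaled_field :
  measurable_fun setT (fun p : V * Omega => rescaled_field p.1 p.2).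
Proof.
apply: measurable_fun_ifT => //; first exact: measurable_ltB.
have h : measurable_fun setT (fun p : V * Omega => (scale_tuple r p.1, p.2)).
  apply: measurable_fun_pair => //.
  exact: measurableT_comp (@measurable_scale_tuple R d r) measurable_fst.
exact: measurableT_comp (measurable_ball_field hZeps e0) h.
Qed.

Lemma measurable_shifted_field :
  measurable_fun setT (fun p : V * (Omega * RM) => shifted_field p.1 p.2).
Proof.
apply: measurable_fun_ifT => //; first exact: measurable_ltB.
apply: measurable_funD.
  have h : measurable_fun setT (fun p : V * (Omega * RM) => (p.1, p.2.1)).
    apply: measurable_fun_pair => //.
    exact: measurableT_comp measurable_fst measurable_snd.
  exact: measurableT_comp (measurable_ball_field hZeps er0) h.
apply: measurable_funM => //.
exact: measurableT_comp measurable_snd measurable_snd.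
Qed.

Let inB (s : seq (R * V)) := [seq p <- s | enorm (p.2 : V) < rho].
Let scaled (s : seq (R * V)) := [seq (p.1, scale_tuple r p.2) | p <- s].

Let rescaled_form s w : linear_form rescaled_field s w =
  linear_form (bf e) (scaled (inB s)) w.
Proof.
rewrite /linear_form /scaled big_map /inB big_filter [RHS]big_mkcond/=.
by apply: eq_bigr => p _; rewrite /rescaled_field; case: ifP; rewrite ?mulr0.
Qed.

Let shifted_form s wn : linear_form shifted_field s wn =
  linear_form (bf (e / r)) (inB s) wn.1 + (\sum_(p <- inB s) p.1) * sigma * wn.2.
Proof.
rewrite /linear_form -mulrA mulr_suml -big_split/= /inB big_filter [RHS]big_mkcond/=.
by apply: eq_bigr => p _; rewrite /shifted_field; case: ifP; rewrite ?mulr0// mulrDr.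
Qed.

Let form_var_scaled s :
  form_var T theta e (scaled (inB s)) =
  form_var T theta (e / r) (inB s) + ((\sum_(p <- inB s) p.1) * sigma) ^+ 2.
Proof.
rewrite exprMn sqr_sqrtr// expr2 big_distrlr/= mulr_suml /form_var /scaled.
rewrite big_map -big_split/=; apply: eq_big_seq => p.
rewrite mem_filter => /andP[/Bpoint[_ pe _ _] _].
rewrite mulr_suml big_map -big_split/=; apply: eq_big_seq => q.
rewrite mem_filter => /andP[/Bpoint[_ qe _ _] _].
by rewrite (field_cov_scale T0 hZ htheta hZeps r0 r1 e0 pe qe) mulrDr.
Qed.

(** Both linear forms are centered normal. The variance of the first is that of
    the second by the scaling of the covariance: the constant [ln(1/r)] contributes
    [sigma^2] times the square of the sum of the coefficients. *)
Lemma rescaled_shifted_law (s : seq (R * V)) (h : R -> \bar R) :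
  measurable_fun setT h -> (forall x, 0 <= h x)%E ->
  (\int[P]_w h (linear_form rescaled_field s w) =
   \int[(P \x N01)%E]_wn h (linear_form shifted_field s wn))%E.
Proof.
move=> mh h0.
have [|v0 e1] := @field_form_law _ _ _ _ P T Z hZ theta Zeps hZeps e (scaled (inB s)) h e0 _ mh h0.
  move=> _ /mapP[p + ->]; rewrite mem_filter => /andP[/Bpoint[_ _ + _] _] /=.
  exact.
under eq_integral do rewrite rescaled_form; rewrite e1 form_var_scaled.
set S := (\sum_(p <- inB s) p.1) * sigma.
have sB p : p \in inB s -> enorm p.2 < 1.
  by rewrite mem_filter => /andP[/Bpoint[]].
under [RHS]eq_integral do rewrite shifted_form -/S.
have mL : measurable_fun setT (linear_form (bf (e / r)) (inB s)).
  by apply: measurable_linear_form => y;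
    exact: (measurable_process (measurable_ball_field hZeps er0)).
rewrite (@fubini_tonelli2 _ _ _ _ _ P N01
  (fun wn => h (linear_form (bf (e / r)) (inB s) wn.1 + S * wn.2)))//; last first.
  apply: (measurableT_comp mh); apply: measurable_funD.
    exact: measurableT_comp mL measurable_fst.
  by apply: measurable_funM => //; exact: measurable_snd.
have law n : 0 <= form_var T theta (e / r) (inB s) /\
  (\int[P]_w h (linear_form (bf (e / r)) (inB s) w + S * n)%R =
   \int[N01]_z h (Num.sqrt (form_var T theta (e / r) (inB s)) * z + S * n)%R)%E.
  apply: (@field_form_law _ _ _ _ P T Z hZ theta Zeps hZeps (e / r) (inB s)
    (fun x => h (x + S * n)) er0 sB) => //.
  by apply: (measurableT_comp mh); exact: measurable_funD.
have [w0 _] := law 0.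
transitivity (\int[N01]_n \int[N01]_z
    h (Num.sqrt (form_var T theta (e / r) (inB s)) * z + S * n)%R)%E.
  by rewrite normal_rotate// sqr_sqrtr.
by apply: eq_integral => n _; rewrite -(law n).2.
Qed.

Lemma rescaled_field_expR_moment :
  (\int[leb]_y ((\1_B y)%:E *
    \int[P]_w (expR (g * `|rescaled_field y w|))%:E) < +oo)%E.
Proof.
have [rho0|rho0] := ltP 0 rho; last first.
  rewrite (_ : (fun _ => _) = cst 0%E) ?integral0//.
  apply/funext => y; rewrite indicE memNset ?mul0e// /eball/=.
  by apply/negP; rewrite -leNgt (le_trans rho0)// enorm_ge0.
have mh : measurable_fun setT (fun x : RM => (expR (g * `|x|))%:E).
  apply/measurable_EFinP; apply: measurableT_comp => //; exact: measurable_funM.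
have hx0 (x : RM) : (0 <= (expR (g * `|x|))%:E)%E by rewrite lee_fin expR_ge0.
pose v := cov e (scale_tuple r (origin d)) (scale_tuple r (origin d)).
have o0 : enorm (origin d : V) < rho by rewrite enorm_origin.
pose C := (\int[N01]_z (expR (g * Num.sqrt v * `|z|))%:E)%E.
have Cfin : C \is a fin_num.
  rewrite ge0_fin_numE; first exact: expR_normal_moment.
  by apply: integral_ge0 => z _; rewrite lee_fin expR_ge0.
apply: (@le_lt_trans _ _ (\int[leb]_y ((\1_B y)%:E * C))%E).
  apply: ge0_le_integral => //.
  - move=> y _; rewrite mule_ge0 ?lee_fin//.
    by apply: integral_ge0 => w _; rewrite lee_fin expR_ge0.
  - apply: emeasurable_funM.
      apply/measurable_EFinP; apply: measurable_indic; exact: measurable_eball.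
    apply: (@measurable_fun_fubini_tonelli_F _ _ _ _ _ P
      (fun p => (expR (g * `|rescaled_field p.1 p.2|))%:E)).
      exact: measurableT_comp mh measurable_rescaled_field.
    by move=> y; rewrite lee_fin expR_ge0.
  - apply: emeasurable_funM; last exact: measurable_cst.
    apply/measurable_EFinP; apply: measurable_indic; exact: measurable_eball.
  - move=> y _; rewrite indicE; have [|yB] := boolP (y \in B); last by rewrite !mul0e.
    rewrite inE /eball/= => yr; rewrite !mul1e.
    have [_ _ sy1 sye] := Bpoint yr.
    have [] := @field_point_law _ _ _ _ P T Z hZ theta Zeps hZeps e _ _ e0 sy1 mh hx0.
    move=> v0 vE; rewrite le_eqVlt; apply/orP; left; apply/eqP.
    transitivity (\int[P]_w (expR (g * `|bf e (scale_tuple r y) w|))%:E)%E.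
      by apply: eq_integral => w _; rewrite /rescaled_field yr.
    rewrite vE; apply: eq_integral => z _.
    rewrite normrM ger0_norm ?sqrtr_ge0// mulrA /v.
    have [_ _ _ soe] := Bpoint o0.
    by rewrite (field_cov_diag T0 htheta e0 sye soe).
rewrite ge0_integralZr//.
- rewrite integral_indic//; last exact: measurable_eball.
  rewrite setIT lte_mul_pinfty//.
    rewrite ge0_fin_numE//; apply: le_lt_trans (lebesgue_tuple_eball_fin d).
    apply: le_measure; rewrite ?inE; [exact: measurable_eball|exact: measurable_eball|].
    by move=> y; rewrite /eball/= => /lt_trans; apply.
  by rewrite ltey_eq Cfin.
- by apply/measurable_EFinP; apply: measurable_indic; exact: measurable_eball.
- by apply: integral_ge0 => z _; rewrite lee_fin expR_ge0.
Qed.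

Lemma shifted_field_expR_moment :
  (\int[leb]_y ((\1_B y)%:E *
    \int[(P \x N01)%E]_w (expR (g * `|shifted_field y w|))%:E) < +oo)%E.
Proof.
apply: le_lt_trans rescaled_field_expR_moment.
rewrite le_eqVlt; apply/orP; left; apply/eqP.
have mh : measurable_fun setT (fun x : RM => (expR (g * `|x|))%:E).
  apply/measurable_EFinP; apply: measurableT_comp => //; exact: measurable_funM.
have hx0 (x : RM) : (0 <= (expR (g * `|x|))%:E)%E by rewrite lee_fin expR_ge0.
apply: eq_integral => y _; congr (_ * _)%E.
have := rescaled_shifted_law [:: (1, y)] mh hx0.
rewrite /linear_form; under eq_integral do rewrite big_seq1 mul1r.
by move=> ->; apply: eq_integral => w _; rewrite big_seq1 mul1r.
Qed.

Lemma laplace_rescaled_shifted (t : R) : 0 <= t ->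
  (\int[P]_w expeR (- (t%:E * exponential_mass leb rescaled_field \1_B g w)) =
   \int[(P \x N01)%E]_w expeR (- (t%:E * exponential_mass leb shifted_field \1_B g w)))%E.
Proof.
move=> t0; apply: laplace_exponential_mass_eq => //.
- exact: measurable_rescaled_field.
- exact: measurable_shifted_field.
- exact: rescaled_shifted_law.
- by apply: measurable_indic; exact: measurable_eball.
- rewrite integral_indic//; last exact: measurable_eball.
  rewrite setIT; apply: le_lt_trans (lebesgue_tuple_eball_fin d).
  apply: le_measure; rewrite ?inE; [exact: measurable_eball|exact: measurable_eball|].
  by move=> y; rewrite /eball/= => /lt_trans; apply.
- exact: ltW.
- exact: rescaled_field_expR_moment.
- exact: shifted_field_expR_moment.
Qed.

Lemma exponential_mass_rescaled w :
  gmc_approx P g Zeps e (eball d (r * rho)) w =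
  ((gmc_normalization T theta g e * r ^+ d)%:E * exponential_mass leb rescaled_field \1_B g w)%E.
Proof.
have rre : r * rho + e < 1.
  rewrite -[e](divfK (lt0r_neq0 r0)) [_ / r * r]mulrC -mulrDr.
  have [h|h] := leP 0 (rho + e / r); first by apply: le_lt_trans rhoe; apply: ler_piMl => //; exact: ltW.
  by rewrite (lt_trans _ ltr01)// pmulr_rlt0.
rewrite (gmc_approx_eball T0 hZ htheta hZeps g w e0 rre) EFinM -muleA; congr (_ * _)%E.
rewrite integral_eball_scale//; last first.
  apply: measurable_funTS.
  exact: measurableT_comp (measurable_expR_ball_field hZeps g e0) (measurable_pair2 w).
congr (_ * _)%E; rewrite integral_mkcond; apply: eq_integral => y _.
rewrite patchE indicE /rescaled_field; case: ifPn => [|yB]; last by rewrite mul0r.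
by rewrite inE /eball/= => ->; rewrite mul1r.
Qed.

Lemma exponential_mass_shifted w n :
  ((gmc_normalization T theta g (e / r))%:E * exponential_mass leb shifted_field \1_B g (w, n) =
   (expR (g * sigma * n))%:E * gmc_approx P g Zeps (e / r) B w)%E.
Proof.
rewrite (gmc_approx_eball T0 hZ htheta hZeps g w er0 rhoe) muleCA; congr (_ * _)%E.
have mG : measurable_fun B (fun y => (expR (g * bf (e / r) y w))%:E).
  apply: measurable_funTS.
  exact: measurableT_comp (measurable_expR_ball_field hZeps g er0) (measurable_pair2 w).
transitivity (\int[leb]_(y in B)
    ((expR (g * sigma * n))%:E * (expR (g * bf (e / r) y w))%:E))%E; last first.
  by rewrite ge0_integralZl// ?lee_fin ?expR_ge0//; exact: measurable_eball.
rewrite [RHS]integral_mkcond; apply: eq_integral => y _.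
rewrite patchE indicE /shifted_field.
have [|yB] := boolP (y \in B); last by rewrite mul0r.
rewrite inE /eball/= => ->; rewrite mul1r -EFinM -expRD.
by congr (expR _)%:E; ring.
Qed.

Definition scaling_factor : R :=
  r ^+ d * expR (- (g ^+ 2 / 2 * (ln r^-1 * @normal_second_moment R))).

Lemma gmc_normalization_scale : 0 < rho ->
  gmc_normalization T theta g e * r ^+ d = scaling_factor * gmc_normalization T theta g (e / r).
Proof.
move=> rho0; have oB : enorm (origin d : V) < rho by rewrite enorm_origin.
have [_ oer _ soe] := Bpoint oB.
have o_e : enorm (origin d : V) + e < 1.
  by rewrite enorm_origin add0r; apply: le_lt_trans soe; rewrite lerDr enorm_ge0.
rewrite /gmc_normalization /scaling_factor -[RHS]mulrA -expRD mulrC; congr (_ * expR _).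
rewrite -(field_cov_diag T0 htheta e0 soe o_e).
by rewrite (field_cov_scale T0 hZ htheta hZeps r0 r1 e0 oer oer); ring.
Qed.

(** After the equality in law, keep only the event [n <= - b] of the additional
    normal variable; there the factor [exp(g sigma n)] is at most
    [exp(- g sigma b)]. *)
Lemma gmc_approx_laplace_ge (t b : R) : 0 < rho -> 0 <= t ->
  (N01 [set z | (z <= - b)%R] *
   \int[P]_w expeR (- ((t * scaling_factor * expR (- (g * sigma * b)))%:E *
     gmc_approx P g Zeps (e / r) B w)) <=
   \int[P]_w expeR (- (t%:E * gmc_approx P g Zeps e (eball d (r * rho)) w)))%E.
Proof.
move=> rho0 t0.
pose c := t * (gmc_normalization T theta g e * r ^+ d).
have rd0 : 0 <= r ^+ d by exact: exprn_ge0 (ltW r0).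
have nz0 e' : 0 <= gmc_normalization T theta g e' by exact: expR_ge0.
have sf0 : 0 <= scaling_factor by rewrite mulr_ge0 ?expR_ge0.
have c0 : 0 <= c by rewrite mulr_ge0 ?mulr_ge0.
have M0 w : (0 <= gmc_approx P g Zeps (e / r) B w)%E.
  by apply: integral_ge0 => x _; rewrite lee_fin expR_ge0.
pose F := (\int[P]_w expeR (- ((t * scaling_factor * expR (- (g * sigma * b)))%:E *
  gmc_approx P g Zeps (e / r) B w)))%E.
rewrite -/F.
have F0 : (0 <= F)%E by apply: integral_ge0 => w _; exact: expeR_ge0.
have -> : (\int[P]_w expeR (- (t%:E * gmc_approx P g Zeps e (eball d (r * rho)) w)) =
    \int[P]_w expeR (- (c%:E * exponential_mass leb rescaled_field \1_B g w)))%E.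
  by apply: eq_integral => w _; rewrite exponential_mass_rescaled muleA -EFinM.
rewrite laplace_rescaled_shifted//.
have w0 y : 0 <= (\1_B y : R) by [].
have mw : measurable_fun setT (\1_B : V -> R).
  by apply: measurable_indic; exact: measurable_eball.
have mE : measurable_fun setT (fun wn : Omega * RM =>
    expeR (- (c%:E * exponential_mass leb shifted_field \1_B g wn)))%E.
  apply: measurable_expeRN.
    apply: emeasurable_funM => //.
    exact: (measurable_exponential_mass leb measurable_shifted_field g mw w0).
  by move=> wn; rewrite mule_ge0 ?lee_fin// exponential_mass_ge0.
rewrite (@fubini_tonelli2 _ _ _ _ _ P N01 (fun wn : Omega * RM =>
    expeR (- (c%:E * exponential_mass leb shifted_field \1_B g wn)))%E)//; last first.
  by move=> wn; exact: expeR_ge0.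
pose A : set RM := [set z | z <= - b].
have mA : measurable A.
  rewrite (_ : A = `]-oo, - b]%classic); first exact: measurable_itv.
  by apply/seteqP; split=> z; rewrite /A /= in_itv.
pose G n := (\int[P]_w expeR (- (c%:E * exponential_mass leb shifted_field \1_B g (w, n))))%E.
have G0 n : (0 <= G n)%E by apply: integral_ge0 => w _; exact: expeR_ge0.
have mG : measurable_fun setT G.
  apply: (@measurable_fun_fubini_tonelli_G _ _ _ _ _ P (fun wn : Omega * RM =>
    expeR (- (c%:E * exponential_mass leb shifted_field \1_B g wn)))%E) => // wn.
  exact: expeR_ge0.
apply: (@le_trans _ _ (\int[N01]_(n in A) G n)%E); last first.
  apply: ge0_subset_integral; [exact: mA|exact: measurableT|exact: mG| |exact: subsetT].
  by move=> n _; exact: G0.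
have -> : (N01 [set z | (z <= - b)%R] * F = \int[N01]_(n in A) cst F n)%E.
  by rewrite integral_cst// muleC.
apply: ge0_le_integral; [exact: mA|by move=> *; exact: F0|exact: measurable_cst|
  exact: measurable_funTS|].
move=> n; rewrite /A/= => nb; rewrite /F /G /=.
apply: ge0_le_integral => //.
- by move=> w _; exact: expeR_ge0.
- apply: measurable_expeRN.
    apply: emeasurable_funM => //.
    exact: (measurable_gmc_approx T0 hZ htheta hZeps g er0 rhoe).
  by move=> w; rewrite mule_ge0 ?M0// lee_fin mulr_ge0 ?expR_ge0// mulr_ge0.
- exact: measurableT_comp mE (measurable_pair2 n).
move=> w _; rewrite lee_expeR leeN2.
rewrite /c gmc_normalization_scale// mulrA EFinM -muleA exponential_mass_shifted muleA -EFinM.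
rewrite lee_wpmul2r// lee_fin ler_wpM2l//.
  by rewrite mulr_ge0.
by rewrite ler_expR -mulrN ler_wpM2l// mulr_ge0 ?sqrtr_ge0// ltW.
Qed.

End gmc_scaling.

(** * Passage to the limit *)

Section laplace_limits.
Context {R : realType} (d : nat) (dO : measure_display)
  (Omega : measurableType dO) (P : probability Omega R).
Local Notation V := (d.-tuple R).
Local Notation N01 := (@normal_prob R 0 1).

(** On nonnegative arguments [exp(- s a)] is [s]-Lipschitz; with infinite values
    the distance is infinite and there is nothing to bound. *)
Lemma expeRN_le (s : R) (a b : \bar R) : 0 < s -> (0 <= a)%E -> (0 <= b)%E ->
  (expeR (- (s%:E * a)) <= expeR (- (s%:E * b)) + s%:E * `|b - a|)%E.
Proof.
move=> s0; have s0' : (0 < s%:E)%E by rewrite lte_fin.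
case: a b => [a| |] [b| |] // a0 b0; rewrite ?(gt0_muley s0')/= ?lee_fin.
- rewrite ?lee_fin in a0 b0 *.
  have sab : s * (b - a) <= s * `|b - a| by rewrite ler_pM2l// ler_norm.

  have [ab|ba] := leP (s * b) (s * a).
    apply: (@le_trans _ _ (expR (- (s * b)))); first by rewrite ler_expR lerN2.
    by rewrite lerDl mulr_ge0// ltW.
  have e1 : expR (- (s * a)) <= 1 by rewrite expR_le1 oppr_le0 mulr_ge0// ltW.
  have e2 := expR_ge1Dx (s * a - s * b).
  have e3 : expR (- (s * b)) = expR (- (s * a)) * expR (s * a - s * b).
    by rewrite -expRD; congr expR; ring.
  have e4 := expR_gt0 (- (s * a)).
  have : expR (- (s * a)) * (1 + (s * a - s * b)) <= expR (- (s * b)).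
    by rewrite e3 ler_pM2l.
  have : (1 - expR (- (s * a))) * (s * a - s * b) <= 0.
    by rewrite mulr_ge0_le0 ?subr_ge0// subr_le0 ltW.
  by move: sab; rewrite mulrBr; lra.
- by rewrite leey.
- by rewrite addeC leey.
- by rewrite add0e leey.
Qed.

Lemma laplace_close (s : R) (X Y : Omega -> \bar R) : 0 < s ->
  measurable_fun setT X -> measurable_fun setT Y ->
  (forall w, 0 <= X w)%E -> (forall w, 0 <= Y w)%E ->
  (\int[P]_w expeR (- (s%:E * X w)) <=
   \int[P]_w expeR (- (s%:E * Y w)) + s%:E * \int[P]_w `|Y w - X w|)%E.
Proof.
move=> s0 mX mY X0 Y0.
have mD : measurable_fun setT (fun w => `|Y w - X w|)%E.
  by apply: measurableT_comp => //; exact: emeasurable_funB.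
have mL (W : Omega -> \bar R) : measurable_fun setT W -> (forall w, 0 <= W w)%E ->
    measurable_fun setT (fun w => expeR (- (s%:E * W w)))%E.
  move=> mW W0; apply: measurable_expeRN; first exact: emeasurable_funM.
  by move=> w; rewrite mule_ge0// lee_fin ltW.
have s0' : (0 <= s%:E)%E by rewrite lee_fin ltW.
have e0 (W : Omega -> \bar R) w : setT w -> (0 <= expeR (- (s%:E * W w)))%E.
  by move=> _; exact: expeR_ge0.
rewrite -ge0_integralZl//.
rewrite -ge0_integralD//.
- apply: ge0_le_integral => //.
  + by move=> w; exact: e0.
  + exact: mL.
  + by apply: emeasurable_funD; [exact: mL|exact: emeasurable_funM].
  + by move=> w _; exact: expeRN_le.
- by move=> w; exact: e0.
- exact: mL.
- by move=> w _; rewrite mule_ge0.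
- exact: emeasurable_funM.
Qed.

End laplace_limits.

Section laplace_continuity.
Context {R : realType}.

Lemma expeRN_fin_num (a : \bar R) : (0 <= a)%E -> expeR (- a) \is a fin_num.
Proof. by case: a. Qed.

Lemma expeRN_cvg (s : R) (u : (\bar R)^nat) (a : \bar R) : 0 < s ->
  (forall n, 0 <= u n)%E -> u @ \oo --> a ->
  (expeR (- (s%:E * u n)) @[n --> \oo] --> expeR (- (s%:E * a)))%E.
Proof.
move=> s0 u0 ua.
have a0 : (0 <= a)%E by apply: cvge_ge ua; exact: nearW.
have su0 x : (0 <= x -> 0 <= s%:E * x)%E by move=> x0; rewrite mule_ge0// lee_fin ltW.
case: a a0 ua => [a| |]// _ ua.
- have [ufin ucvg] := (fine_cvgP _ _).1 ua.
  apply: cvg_trans (_ : (expR (- (s * fine (u n))))%:E @[n --> \oo] --> _).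
    apply: near_eq_cvg; near=> n.
    have {2}<- : (fine (u n))%:E = u n by rewrite fineK//; near: n.
    by [].
  apply: cvg_EFin; first by near=> n.
  apply: (continuous_cvg _ (@continuous_expR R _)).
  by apply: cvgN; apply: cvgM; [exact: cvg_cst|exact: ucvg].
- rewrite gt0_muley ?lte_fin//=; apply/fine_cvgP; split.
    by apply: nearW => n; apply: expeRN_fin_num; exact: su0.
  apply/cvgr0Pnorm_le => eta eta0.
  near=> n; rewrite ger0_norm ?fine_ge0 ?expeR_ge0//.
  rewrite -lee_fin fineK; last by apply: expeRN_fin_num; exact: su0.
  have -> : eta%:E = expeR (- (s%:E * (- ln eta / s)%:E)).
    by rewrite -EFinM mulrC divfK ?lt0r_neq0//= opprK lnK.
  rewrite lee_expeR leeN2; apply: lee_wpmul2l; first by rewrite lee_fin ltW.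
  by near: n; move/cvgeyPge : ua; exact.
Unshelve. all: by end_near. 
Qed.

Context (d : nat) (dO : measure_display)
  (Omega : measurableType dO) (P : probability Omega R).
Variable M : R.-ker Omega ~> d.-tuple R.

Lemma bigcup_eball_scale (r : R) (rho : R^nat) : 0 < r ->
  nondecreasing_seq rho -> (forall n, rho n <= 1) -> rho @ \oo --> (1 : R) ->
  \bigcup_n eball d (r * rho n) = eball d r.
Proof.
move=> r0 ndrho rho1 cvgrho; apply/seteqP; split => x.
  move=> [n _]; rewrite /eball/= => /lt_le_trans; apply.
  by rewrite ler_piMr// ltW.
rewrite /eball/= => xr.
have : enorm x / r < 1 by rewrite ltr_pdivrMr// mul1r.
move=> /(cvgr_gt _ cvgrho)[n _ /(_ n (leqnn n)) xn].
by exists n => //; rewrite /eball/= mulrC -ltr_pdivrMr.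
Qed.

Lemma laplace_cvg (r t : R) (rho : R^nat) : 0 < r -> 0 < t ->
  nondecreasing_seq rho -> (forall n, rho n <= 1) -> rho @ \oo --> (1 : R) ->
  laplace P M (r * rho n) t @[n --> \oo] --> laplace P M r t.
Proof.
move=> r0 t0 ndrho rho1 cvgrho.
have mL r' : measurable_fun setT (fun w => expeR (- (t%:E * M w (eball d r')))).
  apply: measurable_expeRN.
    by apply: emeasurable_funM => //; exact: (measurable_kernel M _ (measurable_eball d r')).
  by move=> w; rewrite mule_ge0// lee_fin ltW.
have [|||||_ _ //] := @dominated_convergence _ _ _ P setT measurableT
  (fun n w => expeR (- (t%:E * M w (eball d (r * rho n)))))
  (fun w => expeR (- (t%:E * M w (eball d r)))) (cst 1%E).
- by move=> n; exact: mL.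
- exact: mL.
- apply: aeW => w _; apply: expeRN_cvg => //.
  rewrite -(bigcup_eball_scale r0 ndrho rho1 cvgrho).
  apply: (@nondecreasing_cvg_mu _ _ _ (M w)).
  + by move=> n; exact: measurable_eball.
  + by apply: bigcup_measurable => n _; exact: measurable_eball.
  + move=> m n mn; apply/subsetPset => x; rewrite /eball/= => /lt_le_trans; apply.
    by rewrite ler_pM2l//; exact: ndrho.
- exact: finite_measure_integrable_cst.
- apply: aeW => w n _; rewrite gee0_abs ?expeR_ge0//= -expeR0 lee_expeR leeNl oppe0.
  by rewrite mule_ge0// lee_fin ltW.
Qed.

Lemma le_laplace (r r' t : R) : 0 <= t -> r <= r' -> (laplace P M r' t <= laplace P M r t)%E.
Proof.
move=> t0 rr'.
have mL s : measurable_fun setT (fun w => expeR (- (t%:E * M w (eball d s)))).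
  apply: measurable_expeRN.
    by apply: emeasurable_funM => //; exact: (measurable_kernel M _ (measurable_eball d s)).
  by move=> w; rewrite mule_ge0.
apply: ge0_le_integral => //.
- by move=> w _; exact: expeR_ge0.
- move=> w _; rewrite lee_expeR leeN2 lee_wpmul2l//.
  apply: le_measure; rewrite ?inE; [exact: measurable_eball|exact: measurable_eball|].
  by move=> x; rewrite /eball/= => /lt_le_trans; apply.
Qed.

Lemma laplace_le1 (r t : R) : 0 <= t -> (laplace P M r t <= 1)%E.
Proof.
move=> t0; rewrite -(probability_setT P) -[leRHS]mul1e -integral_cst//.
apply: ge0_le_integral => //.
- by move=> w _; exact: expeR_ge0.
- apply: measurable_expeRN.
    by apply: emeasurable_funM => //; exact: (measurable_kernel M _ (measurable_eball d r)).
  by move=> w; rewrite mule_ge0.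
- by move=> w _ /=; rewrite -expeR0 lee_expeR leeNl oppe0 mule_ge0.
Qed.

Lemma cbar_ge0 (r : R) : (0 <= cbar P M r)%E.
Proof.
apply: ereal_sup_ubound; exists 0 => //; split => //; exists 1 => // t t1.
rewrite oppr0 mul0r expR0 mulr1; apply: laplace_le1.
exact: le_trans t1.
Qed.

End laplace_continuity.

Section gmc_laplace_scaling.
Context {R : realType} (d : nat) (dO : measure_display)
  (Omega : measurableType dO) (P : probability Omega R).
Local Notation V := (d.-tuple R).
Local Notation N01 := (@normal_prob R 0 1).
Variables (T : R) (Z : signed_measure (R := R) d -> {RV P >-> R}).
Hypotheses (T0 : 0 < T) (hZ : log_gaussian_field T Z).
Variables (theta : probability V R) (htheta : mollifier theta).
Variables (Zeps : R -> V -> Omega -> R) (hZeps : convolution_of T Z theta Zeps).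
Variables (g : R) (M : R.-ker Omega ~> V).
Hypotheses (g0 : 0 < g) (hM : gmc_limit P g Zeps M).
Variable (r : R).
Hypotheses (r0 : 0 < r) (r1 : r < 1).

Local Notation sigma := (Num.sqrt (ln r^-1)).
Local Notation K := (scaling_factor d r g).

Lemma gmc_approx_ge0 e A w : (0 <= gmc_approx P g Zeps e A w)%E.
Proof. by apply: integral_ge0 => x _; rewrite lee_fin expR_ge0. Qed.

Lemma gmc_L1_close (rho eta : R) : rho <= 1 -> 0 < eta ->
  exists2 delta, 0 < delta & forall e, 0 < e -> e < delta ->
  (\int[P]_w `|gmc_approx P g Zeps e (eball d rho) w - M w (eball d rho)| < eta%:E)%E.
Proof.
move=> rho1 eta0; have [|_ cvgM] := hM (measurable_eball d rho).
  by move=> x; rewrite /eball/= => /lt_le_trans; apply.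
have : (0 < eta%:E :> \bar R)%E by rewrite lte_fin.
move=> /open_ereal_lt' /cvgM /nbhs_ballP[delta delta0 close].
exists delta => // e e0 ed; apply: close => //.
by rewrite /ball/= sub0r normrN gtr0_norm.
Qed.

(** The bookkeeping of the errors when [p * A' <= B'] holds for approximations of
    [A] and [B]. It is stated for arbitrary extended reals, which frees the main
    argument from finiteness conditions. *)
Lemma approximate_mule_le (s t eta : R) (p A A' B' B D1 D2 : \bar R) :
  0 < s -> 0 < t -> 0 < eta -> (0 <= p)%E -> (p <= 1)%E -> (0 <= A')%E ->
  (A <= A' + s%:E * D1)%E -> (B' <= B + t%:E * D2)%E -> (p * A' <= B')%E ->
  (D1 < (eta / 2 / s)%:E)%E -> (D2 < (eta / 2 / t)%:E)%E ->
  (p * A <= B + eta%:E)%E.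
Proof.
move=> s0 t0 eta0 p0 p1 A'0 AA' B'B pA' D1s D2t.
have mule_le u D : 0 < u -> (D < (eta / 2 / u)%:E -> u%:E * D <= (eta / 2)%:E)%E.
  by move=> u0 /ltW; rewrite -lee_pdivlMl// -EFinM mulrC.
have h1 := mule_le _ _ s0 D1s; have h2 := mule_le _ _ t0 D2t.
have eta2 : (0 <= (eta / 2)%:E)%E by rewrite lee_fin ltW// divr_gt0.
apply: (@le_trans _ _ (p * (A' + (eta / 2)%:E))%E).
  by apply: lee_wpmul2l => //; apply: le_trans AA' _; apply: leeD2l h1.
rewrite ge0_muleDr// [eta in leRHS]splitr EFinD addeA; apply: leeD.
  by apply: le_trans pA' _; apply: le_trans B'B _; exact: leeD2l.
by rewrite -[leRHS]mul1e; apply: lee_wpmul2r.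
Qed.

Lemma abse_distrC (a b : \bar R) : (`|a - b| = `|b - a|)%E.
Proof. by move: a b => [a| |] [b| |] //=; rewrite distrC. Qed.

(** The limit [e -> 0] of the inequality at positive mollification, at fixed
    [rho]. *)
Lemma gmc_laplace_ball_ge (rho t b : R) : 0 < rho -> rho < 1 -> 0 < t ->
  (N01 [set z | (z <= - b)%R] * laplace P M rho (t * K * expR (- (g * sigma * b))) <=
   laplace P M (r * rho) t)%E.
Proof.
move=> rho0 rho1 t0; set s := t * K * _.
have K0 : 0 < K by rewrite /scaling_factor mulr_gt0 ?expR_gt0 ?exprn_gt0.
have s0 : 0 < s by apply: mulr_gt0; [exact: mulr_gt0|exact: expR_gt0].
have rrho1 : r * rho < 1.
  by apply: le_lt_trans rho1; rewrite ler_piMl// ltW.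
apply/lee_addgt0Pr => eta eta0.
have [d1 d1_0 close1] := gmc_L1_close (ltW rho1) (divr_gt0 (divr_gt0 eta0 (ltr0n _ 2)) s0).
have [d2 d2_0 close2] := gmc_L1_close (ltW rrho1) (divr_gt0 (divr_gt0 eta0 (ltr0n _ 2)) t0).
(* [e / r < 1 - rho], [e / r < d1] and [e < d2] are needed. *)
pose m := Num.min (r * (1 - rho)) (Num.min (r * d1) d2).
have m0 : 0 < m by rewrite !lt_min d2_0 !mulr_gt0// subr_gt0.
pose e := m / 2; have e0 : 0 < e by rewrite divr_gt0.
have : e < m by rewrite /e ltr_pdivrMr// ltr_pMr// ltr1n.
rewrite !lt_min => /and3P[]; rewrite -!(ltr_pdivrMl _ _ r0) [_ * e]mulrC.
rewrite ltrBrDl => rhoe ed1 ed2.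
have re1 : r * rho + e < 1.
  rewrite -[e](divfK (lt0r_neq0 r0)) [_ / r * r]mulrC -mulrDr.
  by apply: le_lt_trans rhoe; rewrite ler_piMl ?addr_ge0// ltW// divr_gt0.
have er0 : 0 < e / r by rewrite divr_gt0.
have mB rho' : measurable_fun setT (fun w => M w (eball d rho')).
  exact: (measurable_kernel M _ (measurable_eball d rho')).
have mX1 := measurable_gmc_approx T0 hZ htheta hZeps g er0 rhoe.
have mX2 := measurable_gmc_approx T0 hZ htheta hZeps g e0 re1.
have M0 rho' w : (0 <= M w (eball d rho'))%E by exact: measure_ge0.
have X0 e' rho' w : (0 <= gmc_approx P g Zeps e' (eball d rho') w)%E.
  exact: gmc_approx_ge0.
have c1 := @laplace_close _ _ _ P s _ _ s0 (mB rho) mX1 (M0 rho) (X0 _ _).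
have c2 := @laplace_close _ _ _ P t _ _ t0 mX2 (mB (r * rho)) (X0 _ _) (M0 _).
have c3 := gmc_approx_laplace_ge T0 hZ htheta hZeps r0 r1 e0 rhoe g0 b rho0 (ltW t0).
have {}close1 := close1 _ er0 ed1.
have {}close2 := close2 _ e0 ed2.
rewrite -/s in c3; rewrite /laplace.
have p1 : (N01 [set z | (z <= - b)%R] <= 1)%E.
  apply: probability_le1.
  rewrite (_ : mkset _ = `]-oo, - b]%classic); first exact: measurable_itv.
  by apply/seteqP; split=> z; rewrite /= in_itv.
have p0 : (0 <= N01 [set z | (z <= - b)%R])%E by exact: measure_ge0.
move: c2; under [X in (_ <= _ + _ * X)%E -> _]eq_integral do rewrite abse_distrC.
move=> c2.
have L0 : (0 <= \int[P]_w expeR (- (s%:E * gmc_approx P g Zeps (e / r) (eball d rho) w)))%E.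
  by apply: integral_ge0 => w _; exact: expeR_ge0.
exact: (approximate_mule_le s0 t0 eta0 p0 p1 L0 c1 c2 c3 close1 close2).
Qed.

(** As [rho] increases to 1 the left side stays above its value at the full ball,
    and the right side converges. *)
Lemma gmc_laplace_ge (t b : R) : 0 < t ->
  (N01 [set z | (z <= - b)%R] * laplace P M 1 (t * K * expR (- (g * sigma * b))) <=
   laplace P M r t)%E.
Proof.
move=> t0; pose rho n : R := 1 - n.+2%:R^-1.
have rho_lt1 n : rho n < 1 by rewrite /rho ltrBlDr ltrDl invr_gt0.
have rho_gt0 n : 0 < rho n by rewrite /rho subr_gt0 invf_lt1// ltr1n.
have ndrho : nondecreasing_seq rho.
  by move=> m n mn; rewrite /rho lerB// lef_pV2 ?posrE// ler_nat.
have cvgrho : rho @ \oo --> (1 : R).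
  rewrite -[X in _ --> X]subr0; apply: cvgB; first exact: cvg_cst.
  by have := @cvg_harmonic R; rewrite -cvg_shiftS.
have := @laplace_cvg _ d _ _ P M r t rho r0 t0 ndrho (fun n => ltW (rho_lt1 n)) cvgrho.
apply: cvge_ge; apply: nearW => n.
apply: le_trans (gmc_laplace_ball_ge b (rho_gt0 n) (rho_lt1 n) t0).
apply: lee_wpmul2l; first exact: measure_ge0.
apply: le_laplace; last exact: ltW.
have K0 : 0 <= K by apply: mulr_ge0; [exact: exprn_ge0 (ltW r0)|exact: expR_ge0].
by apply: mulr_ge0; [apply: mulr_ge0 => //; exact: ltW|exact: expR_ge0].
Qed.

End gmc_laplace_scaling.

(** * Decay exponents *)

(** The cross term [2 lam kappa x] is at most [mu^2 x^2 + (lam kappa / mu)^2]: the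
    linear term costs an arbitrarily small multiple of [x^2]. *)
Lemma shifted_square_le {R : realType} (k lam mu x kappa : R) : 0 < mu ->
  (2 * k ^+ 2)^-1 * (lam * x + kappa) ^+ 2 <=
  (2 * k ^+ 2)^-1 * (lam ^+ 2 + mu ^+ 2) * x ^+ 2 +
  (2 * k ^+ 2)^-1 * (kappa ^+ 2 + (lam * kappa / mu) ^+ 2).
Proof.
move=> mu0; rewrite -mulrA -mulrDr; apply: ler_wpM2l.
  by rewrite invr_ge0 mulr_ge0 ?sqr_ge0.
have := sqr_ge0 (mu * x - lam * kappa / mu).
rewrite sqrrB (_ : mu * x * (lam * kappa / mu) = lam * kappa * x).
  by rewrite !exprMn sqrrD !exprMn; lra.
by field; rewrite gt_eqF.
Qed.

(** With [k = g sigma], [lam = (1 + q) / 2] and [mu = (1 - q) / 2], so that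
    [lam + mu = 1], a point [s] is reached from [t = exp L], [L = ln s / mu], by
    spending [lam L] on the normal variable. Its tail costs [b^2 / 2], at most
    [a (lam^2 + mu^2) L^2] up to a constant, where [lam^2 + mu^2 = (q^2 + 1) / 2]. *)
Lemma gaussian_decay_transfer {R : realType} (F G : R -> \bar R) (k K c C q : R) :
  0 < k -> 0 < K -> 0 < C -> 0 < q -> q < 1 ->
  (forall s, 0 <= G s)%E ->
  (forall t b : R, 0 < t ->
    (@normal_prob R 0 1 [set z | (z <= - b)%R] * G (t * K * expR (- (k * b)))%R <= F t)%E) ->
  (forall t : R, 1 <= t -> (F t <= (C * expR (- c * ln t ^+ 2))%:E)%E) ->
  exists2 C', 0 < C' & forall s : R, 1 <= s ->
    (G s <= (C' * expR (- ((4 * c - 2 * (2 * k ^+ 2)^-1 * (q ^+ 2 + 1)) / (1 - q) ^+ 2) *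
       ln s ^+ 2))%:E)%E.
Proof.
move=> k0 K0 C0 q0 q1 G0 GF Fc.
pose a := (2 * k ^+ 2)^-1; pose lam := (1 + q) / 2; pose mu := (1 - q) / 2.
have mu0 : 0 < mu by rewrite divr_gt0// subr_gt0.
pose kappa := `|ln K| + k.
pose D := a * (kappa ^+ 2 + (lam * kappa / mu) ^+ 2).
have peak0 : 0 < @normal_peak R 1 by rewrite normal_peak_gt0.
exists (C / normal_peak 1 * expR D); first by rewrite mulr_gt0 ?expR_gt0// divr_gt0.
move=> s s1; set l := ln s.
have l0 : 0 <= l by rewrite ln_ge0.
pose L := l / mu; have L0 : 0 <= L by rewrite divr_ge0// ltW.
pose b := (lam * L + ln K) / k.
have sE : expR L * K * expR (- (k * b)) = s.
  rewrite -{1}(lnK (x := K)) ?posrE// -!expRD -[RHS](lnK (x := s)); last first.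
    by rewrite posrE (lt_le_trans ltr01).
  congr expR; rewrite /b mulrC divfK ?gt_eqF// -/l -(divfK (lt0r_neq0 mu0) l) -/L.
  by rewrite /lam /mu; field.
have := GF _ b (expR_gt0 L); rewrite sE => GFs.
have Fs : (F (expR L) <= (C * expR (- c * L ^+ 2))%:E)%E.
  by have := Fc (expR L); rewrite -[X in X <= _]expR0 ler_expR expRK; exact.
have b_le : (`|b| + 1) ^+ 2 / 2 <= a * (lam ^+ 2 + mu ^+ 2) * L ^+ 2 + D.
  apply: le_trans (shifted_square_le k lam L kappa mu0).
  have kb : k * (`|b| + 1) <= lam * L + kappa.
    rewrite mulrDr mulr1 /kappa addrA lerD2r -[k in leLHS]gtr0_norm// -normrM.
    rewrite /b mulrC divfK ?gt_eqF//; apply: le_trans (ler_normD _ _) _.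
    by rewrite lerD2r ger0_norm// mulr_ge0// /lam; lra.
  have -> : (`|b| + 1) ^+ 2 / 2 = (2 * k ^+ 2)^-1 * (k * (`|b| + 1)) ^+ 2.
    by field; rewrite gt_eqF.
  apply: ler_wpM2l; first by rewrite invr_ge0 mulr_ge0 ?sqr_ge0.
  rewrite ler_sqr// nnegrE.
    by rewrite mulr_ge0// ?addr_ge0// ltW.
  by apply: le_trans kb; rewrite mulr_ge0// ?addr_ge0// ltW.
have pG : ((normal_peak 1 * expR (- (a * (lam ^+ 2 + mu ^+ 2) * L ^+ 2 + D)))%:E * G s <=
    (C * expR (- c * L ^+ 2))%:E)%E.
  apply: le_trans Fs; apply: le_trans GFs; apply: lee_wpmul2r; first exact: G0.
  apply: le_trans (normal_tail_ge b); rewrite lee_fin ler_pM2l// ler_expR lerN2.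
  exact: b_le.
rewrite -lee_pdivlMl ?mulr_gt0 ?expR_gt0// -EFinM in pG.
apply: le_trans pG _; rewrite lee_fin le_eqVlt; apply/orP; left; apply/eqP.
have lE : l = mu * L by rewrite /L mulrC divfK// gt_eqF.
rewrite lE invfM -expRN opprK mulrACA [_^-1 * C]mulrC -[RHS]mulrA -!expRD.
congr (_ * expR _); rewrite /a /D /lam /mu.
by field; rewrite subr_eq0 !gt_eqF.
Qed.

Theorem theorem2p9 (R : realType) (d : nat) (hd : (1 <= d)%N)
    (T : R) (hT : Tcrit R d <= T)
    (gamma : R) (hgamma0 : 0 < gamma) (hgamma : gamma < Num.sqrt (2 * d%:R))
    (dO : measure_display) (Omega : measurableType dO) (P : probability Omega R)
    (Z : signed_measure (R := R) d -> {RV P >-> R})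
    (hZ : log_gaussian_field T Z)
    (theta : probability (d.-tuple R) R) (htheta : mollifier theta)
    (Zeps : R -> d.-tuple R -> Omega -> R)
    (hZeps : convolution_of T Z theta Zeps)
    (M : R.-ker Omega ~> d.-tuple R)
    (hM : gmc_limit P gamma Zeps M)
    (q r : R) (hq0 : 0 < q) (hq1 : q < 1) (hr0 : 0 < r) (hr1 : r < 1)
    (hqr : (0 <= cbar P M r - (acoef gamma r / 2 * (q ^+ 2 + 1))%:E)%E) :
  ((4%:E * cbar P M r - (2 * acoef gamma r * (q ^+ 2 + 1))%:E)
     / ((1 - q) ^+ 2)%:E <= cbar P M 1)%E.
Proof.
have T0 : 0 < T.
  apply: lt_le_trans hT; rewrite /Tcrit.
  by case: ifP => _; rewrite ?mulr_gt0 ?expR_gt0.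
have lnr0 : 0 < ln r^-1 by rewrite ln_gt0// invf_gt1.
pose k := gamma * Num.sqrt (ln r^-1).
have k0 : 0 < k by rewrite mulr_gt0 ?sqrtr_gt0.
have -> : acoef gamma r = (2 * k ^+ 2)^-1.
  by rewrite /acoef /k exprMn sqr_sqrtr ?mulrA// ltW.
pose c' c := (4 * c - 2 * (2 * k ^+ 2)^-1 * (q ^+ 2 + 1)) / (1 - q) ^+ 2.
have transfer c : 0 <= c -> (exists2 C : R, 0 < C & forall t : R, 1 <= t ->
      (laplace P M r t <= (C * expR (- c * ln t ^+ 2))%:E)%E) ->
    ((c' c)%:E <= cbar P M 1)%E.
  move=> c0 [C C0 Cc].
  have [c'0|c'0] := leP 0 (c' c).
    apply: ereal_sup_ubound; exists (c' c) => //; split => //.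
    have K0 : 0 < scaling_factor d r gamma by rewrite mulr_gt0 ?exprn_gt0 ?expR_gt0.
    apply: (gaussian_decay_transfer k0 K0 C0 hq0 hq1 _ _ Cc).
      by move=> s; apply: integral_ge0 => w _; exact: expeR_ge0.
    move=> t b t0.
    exact: (gmc_laplace_ge T0 hZ htheta hZeps hgamma0 hM hr0 hr1 b t0).
  by apply: le_trans (cbar_ge0 P M 1); rewrite lee_fin ltW.
have q1 : 0 < (1 - q) ^+ 2 by rewrite exprn_gt0// subr_gt0.
case cE : (cbar P M 1) => [x| |]; last 2 first.
- by rewrite leey.
- by have := cbar_ge0 P M 1; rewrite cE.
(* [y] solves [(4 y - 2 a (q^2 + 1)) / (1 - q)^2 = x]. *)
pose y := (x * (1 - q) ^+ 2 + 2 * (2 * k ^+ 2)^-1 * (q ^+ 2 + 1)) / 4.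
have le_y : (cbar P M r <= y%:E)%E.
  apply: ge_ereal_sup => _ [c [c0 hc] <-].
  have := transfer c c0 hc; rewrite cE lee_fin /c' ler_pdivrMr// => xc.
  by rewrite lee_fin /y ler_pdivlMr// mulrC; lra.
rewrite inver gt_eqF//.
have -> : x = (4 * y - 2 * (2 * k ^+ 2)^-1 * (q ^+ 2 + 1)) * ((1 - q) ^+ 2)^-1.
  by rewrite /y; field; rewrite subr_eq0 !gt_eqF.
rewrite [leRHS]EFinM; apply: lee_wpmul2r; first by rewrite lee_fin invr_ge0 ltW.
rewrite [leRHS]EFinB; apply: leeB => //; rewrite [leRHS]EFinM; exact: lee_wpmul2l.
Qed.
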